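(* Let $\mathsf P$ be a potential graph on $\mathcal N$, $|\mathcal N|=N$, with barrier digraph $V$, and consider the recurrent procedure described in the context. Then: (1) every run of the procedure produces entering spanning forests $F^{(N)},F^{(N-1)},\dots,F^{(1)}$ of $V$ with $F^{(k)}\in\tilde{\mathcal F}^k$ for every $k=1,2,\dots,N$, and $F^{(k-1)}$ is a descendant of $F^{(k)}$ for every $k=2,\dots,N$; (2) for each $k=1,\dots,N$, every forest of $\tilde{\mathcal F}^k$ can be obtained as $F^{(k)}$ in some run of the procedure (i.e. for a suitable resolution of ties); (3) for dense digraphs ($|\mathcal A V|$ of order $N^2$), the total complexity of the procedure is $O(N^3)$ operations.
   Context: A potential graph is a finite connected undirected graph $\mathsf P$ with vertex set $\mathcal N$ and edge set $\mathcal E\mathsf P$, with a loop at every vertex, whose edges and loops carry real weights $p_{ij}=p_{ji}$ (loops: $p_{ii}$). Its barrier digraph $V$ is the loopless digraph on $\mathcal N$ with $(i,j)\in\mathcal A V$, $i\ne j$, iff $(i,j)\in\mathcal E\mathsf P$, with arc weights $v_{ij}=p_{ij}-p_{ii}$. ($\mathcal V G$, $\mathcal A G$ denote vertex set and arc set of a digraph $G$.) An entering forest is a digraph with at most one arc leaving each vertex and no directed cycles; its trees are its connected components; the root of a tree is its unique vertex with no outgoing arc. $\mathcal K_F$ is the set of roots of $F$, and $T^F_i$ is the tree of $F$ with root $i$. $\mathcal F^k$ is the set of spanning entering forests of $V$ (subgraphs of $V$ with vertex set $\mathcal N$) with exactly $k$ trees. The weight is $\Upsilon^F=\sum_{(i,j)\in\mathcal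 A F}v_{ij}$, and $\tilde{\mathcal F}^k\subseteq\mathcal F^k$ is the set of forests of minimum weight in $\mathcal F^k$. For $\mathcal S\subseteq\mathcal N$, $G|_{\mathcal S}$ is the subgraph induced by $\mathcal S$. A forest $G\in\mathcal F^{k-1}$ is a descendant of $F\in\mathcal F^k$ if for some $j\in\mathcal K_F$: $\mathcal K_G=\mathcal K_F\setminus\{j\}$, $G|_{\mathcal V T^F_q}=T^F_q$ for all $q\in\mathcal K_G$, and $G|_{\mathcal V T^F_j}$ is a tree. The procedure. Input: the weights of $\mathsf P$ and $V$ as matrices (missing edges or arcs have weight $\infty$). Start: $F^{(N)}$ is the spanning forest without arcs (all vertices are roots), $p^N_{ij}=p_{ij}$, $v^N_{ij}=v_{ij}$, and the original edge realizing $p^N_{ij}$ is $(i,j)$ itself. For $k=N,N-1,\dots,2$, given $F=F^{(k)}$, the weights $p^k_{li},v^k_{li}$ indexed by $l,i\in\mathcal K_F$, and for each pair $l\neq i$ with $p^k_{li}<\infty$ an original edge of $\mathsf P$ joining $\mathcal V T^F_l$ to $\mathcal V T^F_i$ with weight $p^k_{li}$: (a) choose an ordered pair $(y,x)$ of distinct elements of $\mathcal K_F$ with $v^k_{yx}=\min_{l\ne i}v^k_{li}$; (b) let $(a,b)$ be the recorded original edge with $p_{ab}=p^k_{yx}$, $a\in\mathcal V T^F_y$, $b\in\mathcal V T^F_x$; (c) form $F^{(k-1)}$ from $F$ by reorienting $T^F_y$ (same underlying edges) so that its root is $a$ and adding the arc $(a,b)$; thus $x$ is the root of the merged tree and $y$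 is no longer a root; (d) delete the index $y$; for $l\in\mathcal K_F\setminus\{x,y\}$ set $p^{k-1}_{lx}=p^{k-1}_{xl}=\min(p^k_{lx},p^k_{ly})$, recording the original edge realizing this minimum, and set $v^{k-1}_{lx}=p^{k-1}_{lx}-p_{ll}$, $v^{k-1}_{xl}=p^{k-1}_{lx}-p_{xx}$; all other entries (including loop weights) are unchanged. Ties in all the minima may be resolved arbitrarily. Operations are arithmetic operations and comparisons on weights and elementary list operations. *)

(* Defs.v *)
(* MathComp world; the weight of a missing edge or arc is +oo in \bar R. *)
From mathcomp Require Import all_boot all_order all_algebra.
From mathcomp Require Import reals constructive_ereal.

Set Implicit Arguments.
Unset Strict Implicit.
Unset Printing Implicit Defensive.

Import Order.TTheory GRing.Theory Num.Theory.
Local Open Scope ring_scope.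

Section Digraphs.
Variable T : finType.

Record digraph := Digraph { vertices : {set T}; arcs : {set T * T} }.

Implicit Types (F G H : digraph) (S : {set T}).

Definition has_arc G : rel T := fun i j => (i, j) \in arcs G.

Definition well_formed G : Prop :=
  forall i j, has_arc G i j -> (i \in vertices G) && (j \in vertices G).

Definition subgraph H G : bool :=
  (vertices H \subset vertices G) && (arcs H \subset arcs G).

Definition induced G S : digraph :=
  Digraph (vertices G :&: S)
          [set a in arcs G | (a.1 \in S) && (a.2 \in S)].

Definition has_edge G : rel T := fun i j => has_arc G i j || has_arc G j i.

(* Vertex set of the (weakly) connected component of i. *)
Definition component G (i : T) : {set T} :=
  [set j in vertices G | connect (has_edge G) i j].

Definition components G : {set {set T}} :=
  [set component G i | i in vertices G].

(* A directed cycle is a nonempty duplicate-free closed path; loops and pairs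
   of opposite arcs count as cycles. *)
Definition entering_forest G : Prop :=
  [/\ well_formed G,
      forall i j j', has_arc G i j -> has_arc G i j' -> j = j' &
      forall c : seq T, ucycle (has_arc G) c -> c = [::]].

Definition entering_tree G : Prop :=
  entering_forest G /\ #|components G| = 1%N.

Definition root_set F : {set T} :=
  [set i in vertices F | [forall j, ~~ has_arc F i j]].

(* Meant for i in [root_set F]. *)
Definition tree_at F (i : T) : digraph := induced F (component F i).

(* H is the tree G reoriented, with the same underlying edges, towards a. *)
Definition reorientation G (a : T) H : Prop :=
  [/\ vertices H = vertices G, has_edge H =2 has_edge G,
      entering_tree H & root_set H = [set a]].

End Digraphs.

Arguments Digraph {T}.

Section PotentialGraphs.
Variables (R : realType) (T : finType).

(* [potential i j] is only meaningful when [edge i j] holds. *)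
Record potential_graph := PotentialGraph {
  edge : rel T;
  potential : T -> T -> R;
  vertex_nonempty : (0 < #|T|)%N;
  edge_sym : symmetric edge;
  edge_loop : reflexive edge;
  edge_connected : forall i j, connect edge i j;
  potential_sym : forall i j, edge i j -> potential i j = potential j i }.

Variable P : potential_graph.

Definition barrier_digraph : digraph T :=
  Digraph [set: T] [set a | (a.1 != a.2) && edge P a.1 a.2].

Definition barrier (i j : T) : R := potential P i j - potential P i i.

Definition spanning_forest (k : nat) (F : digraph T) : Prop :=
  [/\ entering_forest F, subgraph F barrier_digraph,
      vertices F = [set: T] & #|components F| = k].

Definition forest_weight (F : digraph T) : R :=
  \sum_(a in arcs F) barrier a.1 a.2.

Definition min_spanning_forest (k : nat) (F : digraph T) : Prop :=
  spanning_forest k F /\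
  forall G, spanning_forest k G -> forest_weight F <= forest_weight G.

Definition descendant (k : nat) (G F : digraph T) : Prop :=
  [/\ spanning_forest k.-1 G, spanning_forest k F &
    exists2 j, j \in root_set F &
      [/\ root_set G = root_set F :\ j,
          forall q, q \in root_set G -> induced G (component F q) = tree_at F q &
          entering_tree (induced G (component F j))]].

Definition potential_matrix (i j : T) : \bar R :=
  if edge P i j then (potential P i j)%:E else +oo%E.

Definition barrier_matrix (i j : T) : \bar R :=
  if (i != j) && edge P i j then (barrier i j)%:E else +oo%E.

End PotentialGraphs.

Section Procedure.
Variables (R : realType) (T : finType) (P : potential_graph R T).

Definition swap (e : T * T) : T * T := (e.2, e.1).

(* The data held at stage k.  Only the entries of the three tables whose
   indices are roots of the current forest matter.  [orig l i] is the recorded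
   edge realizing [pmat l i], oriented from the tree of l to the tree of i. *)
Record state := State {
  forest : digraph T;
  pmat : T -> T -> \bar R;
  vmat : T -> T -> \bar R;
  orig : T -> T -> option (T * T) }.

Definition initial_state : state :=
  State (Digraph [set: T] set0) (potential_matrix P) (barrier_matrix P)
        (fun i j => if edge P i j then Some (i, j) else None).

Definition min_pair (st : state) (y x : T) : Prop :=
  let K := root_set (forest st) in
  [/\ y \in K, x \in K, y != x &
    forall l i, l \in K -> i \in K -> l != i ->
      (vmat st y x <= vmat st l i)%E].

(* The tree of y is rerooted at a, then attached by the arc (a, b). *)
Definition merged (F : digraph T) (y a b : T) (F' : digraph T) : Prop :=
  exists2 H, reorientation (tree_at F y) a H &
    F' = Digraph [set: T]
           ((arcs F :\: arcs (tree_at F y)) :|: arcs H :|: [set (a, b)]).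

Definition updated (st : state) (y x : T) (st' : state) : Prop :=
  let K' := root_set (forest st) :\ y in
  (forall l, l \in K' -> l != x ->
    [/\ pmat st' l x = Order.min (pmat st l x) (pmat st l y),
        pmat st' x l = pmat st' l x,
        (pmat st l x <= pmat st l y)%E /\ orig st' l x = orig st l x \/
        (pmat st l y <= pmat st l x)%E /\ orig st' l x = orig st l y,
        orig st' x l = omap swap (orig st' l x) &
        vmat st' l x = (pmat st' l x - (potential P l l)%:E)%E /\
        vmat st' x l = (pmat st' l x - (potential P x x)%:E)%E]) /\
  (forall l i, l \in K' -> i \in K' -> (l == x) = (i == x) ->
    [/\ pmat st' l i = pmat st l i, vmat st' l i = vmat st l i &
        orig st' l i = orig st l i]).

Definition step (st st' : state) : Prop :=
  exists y x a b,
    [/\ min_pair st y x, orig st y x = Some (a, b),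
        merged (forest st) y a b (forest st') & updated st y x st'].

(* [S #|T|, ..., S k] are successive states of the procedure, S m being the
   state at stage m.  The other values of S are irrelevant. *)
Definition partial_run (k : nat) (S : nat -> state) : Prop :=
  S #|T| = initial_state /\
  forall m, (k < m <= #|T|)%N -> step (S m) (S m.-1).

Definition run (S : nat -> state) : Prop := partial_run 1 S.

End Procedure.

(* Nondeterministic computations with an operation count: [m a t] means that
   some execution of m returns a after t elementary operations. *)
Definition costed (A : Type) : Type := A -> nat -> Prop.

Definition ret (A : Type) (a : A) : costed A :=
  fun b t => b = a /\ t = 0%N.

(* One elementary operation with result a. *)
Definition op (A : Type) (a : A) : costed A :=
  fun b t => b = a /\ t = 1%N.

Definition bind (A B : Type) (m : costed A) (f : A -> costed B) : costed B :=
  fun b t => exists a t1 t2, [/\ m a t1, f a b t2 & t = (t1 + t2)%N].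

Notation "'let!' x := m 'in' f" := (bind m (fun x => f))
  (at level 200, x name, m at level 100, f at level 200).

(* Left-to-right traversal of a list, one operation per element being charged
   in addition to the body. *)
Fixpoint traverse (A B : Type) (f : B -> A -> costed B) (s : seq A) (b : B)
    : costed B :=
  if s is x :: s' then
    let! x' := op x in
    let! b' := f b x' in
    traverse f s' b'
  else ret b.

(* One comparison of weights; a tie may be resolved either way. *)
Definition compare (R : realType) (u w : \bar R) : costed bool :=
  fun b t => (if b then (u <= w)%E else (w <= u)%E) /\ t = 1%N.

Section Program.
Variables (R : realType) (T : finType) (P : potential_graph R T).

Definition read1 (A : Type) (M : T -> A) i : costed A := op (M i).
Definition read (A : Type) (M : T -> T -> A) i j : costed A := op (M i j).

Definition write1 (A : Type) (M : T -> A) i (a : A) : costed (T -> A) :=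
  op (fun i' => if i' == i then a else M i').

Definition write (A : Type) (M : T -> T -> A) i j (a : A)
    : costed (T -> T -> A) :=
  op (fun i' j' => if (i' == i) && (j' == j) then a else M i' j').

Record tables := Tables {
  tp : T -> T -> \bar R;
  tv : T -> T -> \bar R;
  torig : T -> T -> option (T * T) }.

(* A forest is stored as the array of the heads of its arcs: [succ i] is
   Some j for the arc (i, j) leaving i, and None if i is a root. *)
Record store := Store {
  root_list : seq T;
  succ : T -> option T;
  tabs : tables }.

Definition find_min (K : seq T) (v : T -> T -> \bar R)
    : costed (option (T * T)) :=
  traverse (fun best l =>
    traverse (fun best i =>
      let! same := op (l == i) in
      if same then ret best else
      match best with
      | None => op (Some (l, i))
      | Some (y, x) =>
        let! vyx := read v y x in
        let! vli := read v l i in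
        let! keep := compare vyx vli in
        if keep then ret best else op (Some (l, i))
      end) K best) K None.

(* Walk along the arcs from c to the root, reversing them; the arc leaving c
   becomes the one given by new.  Such a path has at most n = #|T| vertices. *)
Fixpoint reroot (n : nat) (s : T -> option T) (c : T) (new : option T)
    : costed (T -> option T) :=
  if n is n'.+1 then
    let! next := read1 s c in
    let! s' := write1 s c new in
    if next is Some d then reroot n' s' d (Some c) else ret s'
  else ret s.

Definition delete (y : T) (K : seq T) : costed (seq T) :=
  traverse (fun acc l =>
    let! same := op (l == y) in
    if same then ret acc else op (l :: acc)) K [::].

Definition update_index (y x : T) (s : tables) (l : T) : costed tables :=
  let! same := op (l == x) in
  if same then ret s else
  let! plx := read (tp s) l x in
  let! ply := read (tp s) l y in
  let! keep := compare plx ply in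
  let m := if keep then plx else ply in
  let! e := read (torig s) l (if keep then x else y) in
  let! p1 := write (tp s) l x m in
  let! p2 := write p1 x l m in
  let! o1 := write (torig s) l x e in
  let! e' := op (omap (@swap T) e) in
  let! o2 := write o1 x l e' in
  let! pll := read p2 l l in
  let! vlx := op (m - pll)%E in
  let! v1 := write (tv s) l x vlx in
  let! pxx := read p2 x x in
  let! vxl := op (m - pxx)%E in
  let! v2 := write v1 x l vxl in
  ret (Tables p2 v2 o2).

(* The two branches [ret s] are never taken, P being connected. *)
Definition step_program (s : store) : costed store :=
  let! best := find_min (root_list s) (tv (tabs s)) in
  if best is Some (y, x) then
    let! e := read (torig (tabs s)) y x in
    if e is Some (a, b) then
      let! succ' := reroot #|T| (succ s) a (Some b) in
      let! K' := delete y (root_list s) in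
      let! tabs' := traverse (update_index y x) K' (tabs s) in
      ret (Store K' succ' tabs')
    else ret s
  else ret s.

Definition output (s : store) : costed (seq (T * T)) :=
  traverse (fun acc i =>
    let! h := read1 (succ s) i in
    if h is Some j then op ((i, j) :: acc) else ret acc) (enum T) [::].

Fixpoint main_loop (n : nat) (s : store) : costed (seq (seq (T * T))) :=
  let! F := output s in
  if n is n'.+1 then
    let! s' := step_program s in
    let! Fs := main_loop n' s' in
    op (F :: Fs)
  else op [:: F].

Definition initial_edges : costed (T -> T -> option (T * T)) :=
  traverse (fun o i =>
    traverse (fun o j =>
      let! pij := read (potential_matrix P) i j in
      let! finite := op (pij < +oo)%E in
      write o i j (if finite then Some (i, j) else None)) (enum T) o)
    (enum T) (fun _ _ => None).

Definition initial_store : costed store :=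
  let! K := traverse (fun acc i => op (i :: acc)) (enum T) [::] in
  let! s := traverse (fun s i => write1 s i None) (enum T) (fun _ => None) in
  let! o := initial_edges in
  ret (Store K s (Tables (potential_matrix P) (barrier_matrix P) o)).

(* The procedure on matrices and lists.  The output is the list of the arc
   lists of F^(N), F^(N-1), ..., F^(1). *)
Definition program : costed (seq (seq (T * T))) :=
  let! s := initial_store in
  main_loop #|T|.-1 s.

Definition outputs_run (out : seq (seq (T * T))) (S : nat -> state R T)
    : Prop :=
  size out = #|T| /\
  forall k, (1 <= k <= #|T|)%N ->
    forest (S k) =
    Digraph [set: T] [set a in nth [::] out (#|T| - k)].

End Program.

(* Main.v *)
Require Import Defs.
From mathcomp Require Import all_boot all_order all_algebra.
From mathcomp Require Import reals constructive_ereal ring lra zify.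
From mathcomp Require boolp.
Set Implicit Arguments.
Unset Strict Implicit.
Unset Printing Implicit Defensive.
Import Order.TTheory GRing.Theory Num.Theory.

(* Since v_ij = p_ij - p_ii, the weight of a spanning entering forest is, up to
   a constant, the weight of its edges plus the loop weights p_qq of its roots:
   it is the weight of a spanning tree of P extended by a vertex joined to
   every q by an edge of weight p_qq, and a forest with k trees is a spanning
   tree of degree k at that vertex.  A symmetric exchange between a forest F
   with k+1 trees and a forest G with k trees, at a root y of F that is not a
   root of G, follows the path of G from y: if the path leaves the tree of y in
   F, F loses a tree and G gains one; otherwise the numbers of trees are kept
   and the root sets of F and G get closer.  Hence if F is minimum, some single
   merge of F weighs no more than G, which gives (1); and if G is minimum, G is
   a merge of a forest that weighs no more than F, which gives (2), where ties
   between recorded edges are broken in favour of the edges of the target. *)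

(** * Forests as successor functions *)

(** A forest is handled as a successor function [T -> option T], which is also what the program
    stores. [linked] forgets orientation, and a forest is determined by its links and its roots; so
    the abstract [reorientation], the one-pass reversal of the program and the merges of the
    exchange argument are all identified by comparing links and roots. The obstacle in (2) is that a
    single edge is recorded between two trees: when a tie is resolved, an edge wanted by a much
    later merge may be lost for good. Hence the final target must be known from the start of the
    run. Splitting it backwards gives a chain of forests whose links are all links of the target,
    and preferences for such links never conflict, since two parts connected by links of a forest
    are joined by at most one further link of it. In (3) the freedom of a stage reduces to the
    chosen pair and to a Boolean function [keep] that resolves ties; the same two data describe a
    step of a run and an execution of the loop body. *)

Section SuccessorFunctions.
Variable T : finType.
Implicit Types (s : T -> option T) (i j c d e r y : T) (new : option T).

(** Roots are fixed points of [up], so iterating too often is harmless; [root_of] can therefore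
    always use [#|T|] iterations. *)
Definition up s i := odflt i (s i).
Definition root_of s i := iter #|T| (up s) i.
Definition acyclic s := forall i, s (root_of s i) = None.
Definition linked s i j := (s i == Some j) || (s j == Some i).
Definition redirect s c new : T -> option T := fun i => if i == c then new else s i.

Lemma up_none s i : s i = None -> up s i = i.
Proof. by rewrite /up => ->. Qed.

Lemma iter_up_none s n i : s i = None -> iter n (up s) i = i.
Proof. by move=> si; elim: n => //= n ->; exact: up_none. Qed.

Lemma root_of_none s i : s i = None -> root_of s i = i.
Proof. exact: iter_up_none. Qed.

Lemma root_of_up s i j : acyclic s -> s i = Some j -> root_of s i = root_of s j.
Proof.
move=> ac sij; have <-: up s i = j by rewrite /up sij.
by rewrite /root_of -iterSr iterS up_none //; exact: ac.
Qed.

Lemma acyclic_ind s (Q : T -> Prop) : acyclic s ->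
  (forall i, s i = None -> Q i) -> (forall i j, s i = Some j -> Q j -> Q i) ->
  forall i, Q i.
Proof.
move=> ac Q0 QS i; have: Q (root_of s i) by exact/Q0/ac.
rewrite /root_of; elim: #|T| => //= n IH; rewrite /up.
by case E: (s _) => [j|] // Qj; apply: IH; exact: QS E Qj.
Qed.

(** A vertex met on the walk from [i] is first met in fewer than [#|T|] steps; being a root, it is
    never left. *)
Lemma reaches_none s n i : s (iter n (up s) i) = None -> s (root_of s i) = None.
Proof.
move=> sn; set r := iter n (up s) i.
have fc : fconnect (up s) i r by exact: fconnect_iter.
have lt : findex (up s) i r <= #|T|.
  exact: leq_trans (ltnW (findex_max fc)) (max_card _).
rewrite /root_of -(subnK lt) iterD iter_findex //.
by rewrite (iter_up_none _ sn).
Qed.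

Lemma acyclicP s : (forall i, exists n, s (iter n (up s) i) = None) -> acyclic s.
Proof. by move=> H i; have [n] := H i; exact: reaches_none. Qed.

(** The rank is the number of steps to the root. It replaces arguments on explicit paths: a walk
    cannot return to a vertex because the rank decreases. *)
Lemma acyclic_rank s : acyclic s ->
  exists h : T -> nat, forall i j, s i = Some j -> h j < h i.
Proof.
move=> ac; have ex i : exists n, s (iter n (up s) i) == None.
  by exists #|T|; apply/eqP/ac.
exists (fun i => ex_minn (ex i)) => i j sij.
case: (ex_minnP (ex j)) => m _ mmin; case: ex_minnP => -[|n] /=.
  by rewrite sij.
move=> sn _; rewrite ltnS; apply: mmin.
by move: sn; rewrite -iterS iterSr /up sij.
Qed.

Lemma root_of_linked s i j : acyclic s -> linked s i j -> root_of s i = root_of s j.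
Proof. by move=> ac /orP[]/eqP /(root_of_up ac). Qed.

Lemma linkedC s : symmetric (linked s).
Proof. by move=> i j; rewrite /linked orbC. Qed.

Lemma connect_root_of s i : connect (linked s) i (root_of s i).
Proof.
rewrite /root_of; elim: #|T| => //= n IH; apply: connect_trans IH _.
set j := iter n _ _; case E: (s j) => [k|]; last by rewrite up_none.
by apply: connect1; rewrite /linked /up E eqxx.
Qed.

Lemma connect_linked s i j : acyclic s ->
  connect (linked s) i j = (root_of s i == root_of s j).
Proof.
move=> ac; apply/idP/eqP => [/connectP[p] | rij].
  elim: p i => [i _ -> //|k p IH i /= /andP[lik kp] jE].
  by rewrite (root_of_linked ac lik); exact: IH.
rewrite (connect_trans (connect_root_of s i)) // rij.
by rewrite (sym_connect_sym (@linkedC s)) connect_root_of.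
Qed.

Lemma root_of_linked_eq s t i j : acyclic s -> acyclic t -> linked s =2 linked t ->
  (root_of s i == root_of s j) = (root_of t i == root_of t j).
Proof. by move=> acs act st; rewrite -!connect_linked //; apply: eq_connect. Qed.

Lemma root_of_linked_sub s t i j : acyclic s -> acyclic t ->
  (forall a b, linked s a b -> linked t a b) ->
  root_of s i = root_of s j -> root_of t i = root_of t j.
Proof.
move=> acs act st /eqP; rewrite -connect_linked // => cij; apply/eqP.
rewrite -connect_linked //; apply: connect_sub cij => a b /st; exact: connect1.
Qed.

(* If [s i = Some j] while t has the arc (j, i), then j is not a root and its
   arc, which is common to s and t by induction, closes a 2-cycle in s. *)
Lemma eq_linked_roots s t : acyclic s ->
  linked s =2 linked t -> (forall i, (s i == None) = (t i == None)) -> s =1 t.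
Proof.
move=> ac st nn; have [h hP] := acyclic_rank ac.
have key : forall i j, s i = Some j -> t i = Some j.
  apply: (acyclic_ind ac) => [i -> //|i j sij IH k]; rewrite sij => -[<-].
  have: linked t i j by rewrite -st /linked sij eqxx.
  case/orP => /eqP // tji.
  have: s j != None by rewrite nn tji.
  case E: (s j) => [l|] // _; have:= IH _ E; rewrite tji => -[li].
  by have := ltn_trans (hP _ _ E) (hP _ _ sij); rewrite li ltnn.
move=> i; case E: (s i) => [j|]; first by rewrite (key _ _ E).
by have := nn i; rewrite E eqxx => /esym/eqP.
Qed.

(** * Changing the successor of one vertex *)

Section Redirect.
Variables (s : T -> option T) (c : T) (new : option T).
Hypotheses (ac : acyclic s)
  (new_out : forall e, new = Some e -> root_of s e <> root_of s c).
Let t := redirect s c new.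

Lemma redirect_other i : i != c -> t i = s i.
Proof. by rewrite /t /redirect => /negbTE ->. Qed.

Lemma redirect_same : t c = new.
Proof. by rewrite /t /redirect eqxx. Qed.

Lemma acyclic_redirect : acyclic t.
Proof.
have RS i j : t i = Some j -> (exists n, t (iter n (up t) j) = None) ->
    exists n, t (iter n (up t) i) = None.
  by move=> tij [n tn]; exists n.+1; rewrite iterSr /up tij.
(* Outside the tree of [c] the walk never meets [c], so it is unchanged. *)
have out : forall i, root_of s i <> root_of s c ->
    exists n, t (iter n (up t) i) = None.
  apply: (acyclic_ind ac) => [i si nic|i j sij IH nic].
    by exists 0; rewrite /= redirect_other //; apply: contra_notN nic => /eqP->.
  apply: (RS i j); first by rewrite redirect_other //; apply: contra_notN nic => /eqP->.
  by apply: IH; rewrite -(root_of_up ac sij).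
have atc : exists n, t (iter n (up t) c) = None.
  case E: new => [e|]; last by exists 0; rewrite /= redirect_same.
  by apply: (RS c e); [rewrite redirect_same|exact/out/new_out].
apply: acyclicP; apply: (acyclic_ind ac) => [i si|i j sij IH].
  by case: (eqVneq i c) => [->//|ic]; exists 0; rewrite /= redirect_other.
by case: (eqVneq i c) => [->//|ic]; apply: RS IH; rewrite redirect_other.
Qed.

Lemma root_of_redirect_other i :
  root_of s i <> root_of s c -> root_of t i = root_of s i.
Proof.
move: i; apply: (acyclic_ind ac) => [i si nic|i j sij IH nic].
  have ic : i != c by apply: contra_notN nic => /eqP->.
  by rewrite !root_of_none // redirect_other.
have ic : i != c by apply: contra_notN nic => /eqP->.
rewrite (root_of_up ac sij) -IH ?(root_of_up acyclic_redirect (j:=j)) //.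
  by rewrite redirect_other.
by rewrite -(root_of_up ac sij).
Qed.

(** Ranks decrease along the walk from [d], so it never comes back to [c] and does not see the
    redirection. *)
Lemma root_of_redirect_up d : s c = Some d -> root_of t d = root_of s c.
Proof.
have [h hP] := acyclic_rank ac; move=> scd; rewrite (root_of_up ac scd).
move: (hP _ _ scd); move: d {scd}; apply: (acyclic_ind ac) => [i si hi|i j sij IH hi].
  have ic : i != c by apply: contraTneq hi => ->; rewrite ltnn.
  by rewrite !root_of_none // redirect_other.
have ic : i != c by apply: contraTneq hi => ->; rewrite ltnn.
rewrite (root_of_up ac sij) -IH ?(ltn_trans (hP _ _ sij)) //.
by apply: root_of_up acyclic_redirect _; rewrite redirect_other.
Qed.

Lemma root_of_redirect :
  root_of t c = if new is Some e then root_of s e else c.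
Proof.
case E: new => [e|]; last by rewrite root_of_none // redirect_same.
rewrite (root_of_up acyclic_redirect (j := e)) ?redirect_same //.
by rewrite root_of_redirect_other //; exact: new_out.
Qed.

End Redirect.

Definition tree_set s i : {set T} := [set j | root_of s j == root_of s i].

(** What the induction on path reversal needs: [c] and [d] are now in different trees, so sending
    [d] back to [c] is a legal redirection in its turn, and the tree of [d] has lost [c], which
    bounds the recursion. *)
Lemma redirect_up s c new d (t := redirect s c new) :
  acyclic s -> (forall e, new = Some e -> root_of s e <> root_of s c) ->
  s c = Some d ->
  [/\ root_of t d = root_of s c, root_of t c <> root_of t d
    & #|tree_set t d| < #|tree_set s c|].
Proof.
move=> ac out E; have act : acyclic t by exact: acyclic_redirect.
have rd : root_of t d = root_of s c by exact: root_of_redirect_up.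
have cnr : c != root_of s c.
  by apply/eqP => cr; have := ac c; rewrite -cr E.
have rc : root_of t c <> root_of t d.
  rewrite rd root_of_redirect //; case N: new => [e|]; first exact: out.
  exact/eqP.
split=> //; apply: proper_card; apply/properP; split.
  apply/subsetP => i; rewrite !inE rd => /eqP ri; apply/eqP.
  apply: contra_eq ri => /eqP nri; rewrite (root_of_redirect_other ac out nri).
  exact/eqP.
by exists c; rewrite !inE ?eqxx //; exact/eqP.
Qed.

(** Same recursion as the program [reroot]. The fuel [n] is enough as soon as it is at least the
    size of the tree of [c]. *)
Fixpoint reverse_path (n : nat) s c new : T -> option T :=
  if n is n'.+1 then
    if s c is Some d then reverse_path n' (redirect s c new) d (Some c)
    else redirect s c new
  else s.

(** Each step drops the link between [c] and [d], and the next one restores it with the opposite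
    orientation. So the only new link is the one given by [new], and only the root at the end of the
    path can be lost. *)
Lemma reverse_path_spec n s c new (s' := reverse_path n s c new) :
  acyclic s -> (forall e, new = Some e -> root_of s e <> root_of s c) ->
  #|tree_set s c| <= n ->
  [/\ acyclic s',
      linked s' =2 (fun i j => [|| linked s i j, (i == c) && (new == Some j)
                                 | (j == c) && (new == Some i)]),
      forall i, (s' i == None) =
        if i == c then new == None else (s i == None) && (i != root_of s c),
      forall i, root_of s i <> root_of s c -> s' i = s i &
      s' c = new].
Proof.
rewrite {}/s'; elim: n s c new => [|n IH] s c new ac out.
  by rewrite leqn0 => /eqP/cards0_eq/setP/(_ c); rewrite !inE eqxx.
move=> szn /=; set t := redirect s c new.
have act : acyclic t by exact: acyclic_redirect.
case E: (s c) => [d|]; last first.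
  split=> //.
  - move=> i j; rewrite /linked /t /redirect; case: (eqVneq i c) => [->|ic];
      case: (eqVneq j c) => [->|jc] //=; rewrite ?E /= ?orbF //=; rewrite orbC //.
  - move=> i; rewrite /t /redirect; case: (eqVneq i c) => // ic.
    by rewrite (root_of_none E) ic andbT.
  - by move=> i nic; rewrite /t redirect_other //; apply: contra_notN nic => /eqP->.
  - exact: redirect_same.
have [rd rc szd] := redirect_up ac out E.
have cnr : c != root_of s c.
  by apply/eqP => cr; have := ac c; rewrite -cr E.
have [] := IH t d (Some c) act.
- by move=> e [<-].
- by rewrite -ltnS; exact: leq_trans szn.
move=> ac' lk rt oth dE.
have dc : d != c by apply: contra_notN rc => /eqP->.
split=> //.
- move=> i j; rewrite lk /linked /t /redirect.
  case: (eqVneq i c) => [->|ic]; case: (eqVneq j c) => [->|jc] //=; rewrite ?E /=.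
  + by rewrite !(inj_eq Some_inj) (eq_sym c d) (negbTE dc); case: (new == _).
  + rewrite !(inj_eq Some_inj) eqxx (eq_sym c j) (negbTE jc) (eq_sym c d) (negbTE dc).
    by rewrite andbT /= (eq_sym j) !orbF; case: (new == _); case: (d == j); case: (s j == _).
  + rewrite !(inj_eq Some_inj) eqxx (eq_sym c i) (negbTE ic) (eq_sym c d) (negbTE dc).
    by rewrite !andbT /= (eq_sym i) ?andbF ?orbF; case: (new == _); case: (d == i); case: (s i == _).
  + by rewrite !(inj_eq Some_inj) (eq_sym c j) (eq_sym c i) (negbTE ic) (negbTE jc) !andbF !orbF.
- move=> i; rewrite rt rd /t /redirect.
  case: (eqVneq i d) => [->|idd].
    rewrite (negbTE dc) /=; apply/esym/negbTE; rewrite negb_and negbK.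
    case D: (s d) => [|] //=; first by rewrite (root_of_up ac E) root_of_none.
  by case: (eqVneq i c) => [->|//]; rewrite cnr andbT.
- move=> i nic; rewrite oth ?rd ?root_of_redirect_other //.
  by rewrite /t redirect_other //; apply: contra_notN nic => /eqP->.
- by rewrite oth /t ?redirect_same.
Qed.

Definition roots s : {set T} := [set i | s i == None].
Definition rerooted s c new := reverse_path #|T| s c new.

Lemma roots_root_of s i : acyclic s -> root_of s i \in roots s.
Proof. by move=> ac; rewrite inE ac. Qed.

Section Reroot.
Variables (s : T -> option T) (c : T).
Hypothesis ac : acyclic s.

Let none_out e : None = Some e -> root_of s e <> root_of s c. Proof. by []. Qed.
Let noneP := reverse_path_spec ac none_out (max_card _).

Lemma acyclic_reroot_none : acyclic (rerooted s c None).
Proof. by have [] := noneP. Qed.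

Lemma linked_reroot_none : linked (rerooted s c None) =2 linked s.
Proof. by have [_ lk _ _ _] := noneP => i j; rewrite lk !andbF !orbF. Qed.

Lemma roots_reroot_none : roots (rerooted s c None) = c |: (roots s :\ root_of s c).
Proof.
have [_ _ rt _ _] := noneP; apply/setP => i; rewrite !inE rt.
by case: (eqVneq i c) => //= _; rewrite andbC.
Qed.

Lemma reroot_none_same : rerooted s c None c = None.
Proof. by have [] := noneP. Qed.

Variable d : T.
Hypothesis cd : root_of s c <> root_of s d.

Let some_out e : Some d = Some e -> root_of s e <> root_of s c.
Proof. by case=> <-; exact/nesym. Qed.
Let someP := reverse_path_spec ac some_out (max_card _).

Lemma acyclic_reroot_some : acyclic (rerooted s c (Some d)).
Proof. by have [] := someP. Qed.

Lemma linked_reroot_some i j : linked (rerooted s c (Some d)) i j =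
  [|| linked s i j, (i == c) && (j == d) | (i == d) && (j == c)].
Proof.
have [_ lk _ _ _] := someP; rewrite lk !(inj_eq Some_inj) ![d == _]eq_sym.
by rewrite [(j == c) && _]andbC.
Qed.

Lemma roots_reroot_some : roots (rerooted s c (Some d)) = roots s :\ root_of s c.
Proof.
have [_ _ rt _ _] := someP; apply/setP => i; rewrite !inE rt.
case: (eqVneq i c) => [->|_]; last by rewrite andbC.
case E: (s c == None); last by rewrite andbF.
by rewrite root_of_none ?eqxx //; exact/eqP.
Qed.

Lemma reroot_some_other i :
  root_of s i <> root_of s c -> rerooted s c (Some d) i = s i.
Proof. by have [_ _ _ oth _] := someP; exact: oth. Qed.

Lemma reroot_some_same : rerooted s c (Some d) c = Some d.
Proof. by have [] := someP. Qed.

Lemma root_of_reroot_some i : root_of (rerooted s c (Some d)) i =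
  if root_of s i == root_of s c then root_of s d else root_of s i.
Proof.
set t := rerooted _ _ _; have act : acyclic t by exact: acyclic_reroot_some.
have sub a b : root_of s a = root_of s b -> root_of t a = root_of t b.
  by apply: root_of_linked_sub => // x y; rewrite linked_reroot_some => ->.
have fixr j : root_of s j <> root_of s c -> root_of t j = root_of s j.
  move=> njc; rewrite (sub j (root_of s j)); last by rewrite (root_of_none (ac j)).
  apply/root_of_none/eqP.
  have: root_of s j \in roots t.
    by rewrite roots_reroot_some in_setD1 roots_root_of // andbT; exact/eqP.
  by rewrite inE.
case: eqP => [/sub ->|/fixr //].
rewrite (@root_of_up t c d) //; [exact: fixr (nesym cd)|exact: reroot_some_same].
Qed.

(** The program reverses and attaches in one pass, while [merged] reorients first and adds the arc
    afterwards; the two results have the same links and the same roots. *)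
Lemma redirect_reroot_none :
  redirect (rerooted s c None) c (Some d) =1 rerooted s c (Some d).
Proof.
set t := rerooted s c None; have act : acyclic t by exact: acyclic_reroot_none.
have rtE a b : (root_of t a == root_of t b) = (root_of s a == root_of s b).
  by apply: root_of_linked_eq => //; exact: linked_reroot_none.
have tc : t c = None by exact: reroot_none_same.
apply: eq_linked_roots.
- apply: acyclic_redirect => // e [<-] /eqP; rewrite rtE => /eqP; exact/nesym.
- move=> i j; rewrite linked_reroot_some -(linked_reroot_none i j) -/t.
  rewrite /linked /redirect.
  case: (eqVneq i c) => [->|ic]; case: (eqVneq j c) => [->|jc] //=;
    rewrite ?tc ?(inj_eq Some_inj) ?(eq_sym d) ?andbT ?andbF ?orbF /= ?orbF; rewrite 1?orbC //.
- move=> i; rewrite /redirect; case: (eqVneq i c) => [->|ic].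
    by rewrite reroot_some_same.
  have := roots_reroot_none; move/setP/(_ i).
  have := roots_reroot_some; move/setP/(_ i).
  by rewrite !inE (negbTE ic) /= => -> ->.
Qed.

End Reroot.

End SuccessorFunctions.

(** * Weights of forests under path reversal *)

Section Weights.
Variables (T : finType) (R : realType) (f : T -> T -> R) (l : T -> R).
Hypothesis fC : forall i j, f i j = f j i.
Implicit Types (s : T -> option T) (i j c d e r y : T) (new : option T).
Local Open Scope ring_scope.

(* With this charge for roots, reversing a path changes the weight of a forest
   only at the ends of the path. *)
Definition link_weight i o := if o is Some j then f i j else l i.
Definition weight s : R := \sum_i link_weight i (s i).

Lemma eq_weight s t : s =1 t -> weight s = weight t.
Proof. by move=> st; apply: eq_bigr => i _; rewrite st. Qed.

Lemma weight_redirect s c new :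
  weight (redirect s c new) = weight s - link_weight c (s c) + link_weight c new.
Proof.
rewrite /weight (bigD1 c) //= [in RHS](bigD1 c) //= redirect_same.
rewrite [link_weight c (s c) + _]addrC addrK addrC; congr (_ + _).
by apply: eq_bigr => i ic; rewrite redirect_other.
Qed.

(** By symmetry of [f], the reversed arc from [d] to [c] repays the arc from [c] to [d] removed one
    step before; only the charge of the old root and that of [new] survive. *)
Lemma weight_reverse_path n s c new :
  acyclic s -> (forall e, new = Some e -> root_of s e <> root_of s c) ->
  (#|tree_set s c| <= n)%N ->
  weight (reverse_path n s c new) = weight s - l (root_of s c) + link_weight c new.
Proof.
elim: n s c new => [|n IH] s c new ac out.
  by rewrite leqn0 => /eqP/cards0_eq/setP/(_ c); rewrite !inE eqxx.
move=> szn /=; case E: (s c) => [d|]; last first.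
  by rewrite weight_redirect E root_of_none.
have [rd rc szd] := redirect_up ac out E.
rewrite IH ?rd; first last.
- by rewrite -ltnS; exact: leq_trans szn.
- by move=> e [<-]; rewrite -rd.
- exact: acyclic_redirect.
rewrite weight_redirect E /= (fC d c).
ring.
Qed.

Lemma weight_reroot s c new :
  acyclic s -> (forall e, new = Some e -> root_of s e <> root_of s c) ->
  weight (rerooted s c new) = weight s - l (root_of s c) + link_weight c new.
Proof. by move=> ac out; rewrite weight_reverse_path // max_card. Qed.

End Weights.

(** * The exchange property *)

Section Exchange.
Variables (T : finType) (R : realType) (f : T -> T -> R) (l : T -> R) (e : rel T).
Hypotheses (fC : forall i j, f i j = f j i) (eC : symmetric e).
Implicit Types (s F G : T -> option T) (i j c d r y : T).

Definition forest_in k s :=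
  [/\ acyclic s, forall i j, linked s i j -> e i j & #|roots s| = k].

Lemma forest_in_reroot_none k s c :
  forest_in k s -> forest_in k (rerooted s c None).
Proof.
case=> ac ed kE; split; first exact: acyclic_reroot_none.
  by move=> i j; rewrite linked_reroot_none //; exact: ed.
rewrite roots_reroot_none // -kE (cardsD1 (root_of s c) (roots s)).
rewrite roots_root_of // cardsU1; congr addn.
by rewrite !inE; case: eqVneq => //= cr; case: eqP => // /root_of_none sc; rewrite sc eqxx in cr.
Qed.

Lemma forest_in_reroot_some k s c d : forest_in k.+1 s ->
  root_of s c <> root_of s d -> e c d -> forest_in k (rerooted s c (Some d)).
Proof.
case=> ac ed kE cd ecd; split; first exact: acyclic_reroot_some.
  move=> i j; rewrite linked_reroot_some // => /or3P[/ed //|/andP[/eqP-> /eqP->] //|/andP[/eqP-> /eqP->]].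
  by rewrite eC.
apply: succn_inj; rewrite roots_reroot_some // -kE (cardsD1 (root_of s c) (roots s)).
by rewrite roots_root_of.
Qed.

Lemma linked_redirect_none s c i j : linked (redirect s c None) i j -> linked s i j.
Proof.
by rewrite /linked /redirect; case: (i == c); case: (j == c) => //=;
  rewrite ?orbF => ->; rewrite ?orbT.
Qed.

Lemma forest_in_cut k s c d :
  forest_in k s -> s c = Some d -> forest_in k.+1 (redirect s c None).
Proof.
case=> ac ed kE cd; split; first exact: acyclic_redirect.
  by move=> i j /linked_redirect_none /ed.
have -> : roots (redirect s c None) = c |: roots s.
  by apply/setP => i; rewrite !inE /redirect; case: (eqVneq i c).
by rewrite cardsU1 inE cd kE.
Qed.

(** The first exit on the walk from [i] is taken; the walk up to [c] is not affected by the cut,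
    hence the last conjunct. *)
Lemma exit_arc s (C : {set T}) i : acyclic s -> i \in C -> root_of s i \notin C ->
  exists c d, [/\ c \in C, d \notin C, s c = Some d
                & root_of (redirect s c None) i = c].
Proof.
move=> ac; move: i; apply: (acyclic_ind ac) => [i si iC|i j sij IH iC].
  by rewrite root_of_none // iC.
rewrite (root_of_up ac sij) => rC.
have [jC|jC] := boolP (j \in C); last first.
  by exists i, j; split=> //; rewrite root_of_none // redirect_same.
have [c [d [cC dC scd rj]]] := IH jC rC; exists c, d; split=> //.
have [->|ic] := eqVneq i c; first by rewrite root_of_none // redirect_same.
rewrite (@root_of_up _ _ i j) ?redirect_other //; exact: acyclic_redirect.
Qed.

Local Open Scope ring_scope.

(* Symmetric exchange between the spanning trees that F and G become once a
   vertex joined to every i by an edge of weight [l i] is added to the graph. *)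
Lemma forest_exchange k F G : forest_in k.+1 F -> forest_in k G ->
  (exists c d G', [/\ root_of F c <> root_of F d, e c d,
     forest_in k.+1 G', root_of G' c <> root_of G' d &
     G =1 rerooted G' c (Some d)] /\
     weight f l G' = weight f l G - f c d + l (root_of F c)) \/
  (exists F' G', [/\ forest_in k.+1 F', forest_in k G',
     weight f l F' + weight f l G' = weight f l F + weight f l G,
     (#|roots F' :\: roots G| < #|roots F :\: roots G|)%N &
     (#|roots F :\: roots G'| < #|roots F :\: roots G|)%N]).
Proof.
move=> FP GP; have [acF eF kF] := FP; have [acG eG kG] := GP.
(* [F] has one root more than [G]. *)
have [y] : exists y, y \in roots F :\: roots G.
  apply/set0Pn; rewrite setD_eq0; apply: contraTN isT => /subset_leq_card.
  by rewrite kF kG ltnn.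
rewrite !inE => /andP[/eqP yG /eqP yF].
have ry : root_of F y = y by exact: root_of_none.
have yC : y \in tree_set F y by rewrite inE.
have [rC|rC] := boolP (root_of G y \in tree_set F y).
  (* In the extended trees, the edges joining [y] and [r] to the extra vertex are swapped: the tree
     of [y] in [F] gets the root [r], and the tree of [y] in [G] gets the root [y] instead of
     [r]. *)
  right; set r := root_of G y in rC *.
  have rF : root_of F r = y by move: rC; rewrite inE ry => /eqP.
  have Gr : G r = None by exact: acG.
  have ny : r <> y by move=> E; rewrite E in Gr.
  have Fr : F r <> None by move=> /root_of_none; rewrite rF => /esym.
  exists (rerooted F r None), (rerooted G y None); split.
  - exact: forest_in_reroot_none.
  - exact: forest_in_reroot_none.
  - by rewrite !weight_reroot //= rF -/r; ring.
  - apply/proper_card/properP; split; last first.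
      exists y; rewrite ?roots_reroot_none // !inE ?yF ?rF ?eqxx ?andbF ?orbF ?andbT.
        exact/eqP.
      by rewrite [y == r]eq_sym (introF eqP ny) andbF.
    apply/subsetP => i; rewrite roots_reroot_none // !inE rF.
    case: (eqVneq i r) => [->|_] /=; first by rewrite Gr.
    by case/and3P => -> _ ->.
  - apply/proper_card/properP; split; last first.
      exists y; rewrite ?roots_reroot_none // !inE ?yF ?rF ?eqxx ?andbF ?orbF ?andbT //.
      exact/eqP.
    apply/subsetP => i; rewrite roots_reroot_none // !inE -/r negb_or negb_and negbK.
    case/andP=> /andP[iy /orP[/eqP->|->]] //.
    by move/eqP: Fr => /negbTE ->.
(* Cutting the exit arc [(c, d)] of [G] and rerooting the severed part at [y] trades [f c d] for
   [l y], where [y] is also the root of [c] in [F]. *)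
left; have [c [d [cC dC Gcd rc]]] := exit_arc acG yC rC.
set G1 := redirect G c None in rc.
have G1P : forest_in k.+1 G1 by exact: forest_in_cut GP Gcd.
have [acG1 _ _] := G1P.
have [rd ncd _] := @redirect_up _ _ _ None _ acG (fun _ (E : None = Some _) => match E with end) Gcd.
have rcF : root_of F c = y by move: cC; rewrite inE ry => /eqP.
have rdF : root_of F d <> y by move: dC; rewrite inE ry => /eqP.
have G1c : root_of G1 c = c by rewrite root_of_none // /G1 redirect_same.
set G' := rerooted G1 y None; exists c, d, G'.
have G'P : forest_in k.+1 G' by exact: forest_in_reroot_none.
have [acG' _ _] := G'P.
have rtE a b : (root_of G' a == root_of G' b) = (root_of G1 a == root_of G1 b).
  by apply: root_of_linked_eq => //; exact: linked_reroot_none.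
have ncd' : root_of G' c <> root_of G' d by move/eqP; rewrite rtE => /eqP.
have yc : root_of G' c = y.
  have /eqP -> : root_of G' c == root_of G' y by rewrite rtE rc G1c.
  by rewrite root_of_none //; exact: reroot_none_same.
split; [split=> //|].
- by rewrite rcF; exact/nesym.
- by apply: eG; rewrite /linked Gcd eqxx.
- apply: eq_linked_roots => //.
    move=> i j; rewrite linked_reroot_some // linked_reroot_none // /G1 /linked /redirect.
    case: (eqVneq i c) => [->|ic]; case: (eqVneq j c) => [->|jc] //=;
      rewrite ?Gcd ?(inj_eq Some_inj) ?(eq_sym d) ?andbT ?andbF ?orbF /= ?orbF ?orbb //.
    by rewrite orbC.
  move=> i; have := roots_reroot_some acG' ncd' => /setP/(_ i).
  rewrite yc !inE => ->; have := roots_reroot_none y acG1 => /setP/(_ i).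
  rewrite !inE => ->; rewrite rc /G1 /redirect.
  case: (eqVneq i y) => [->|iy] /=; first exact/negbTE/eqP.
  by case: (eqVneq i c) => [->|//]; rewrite Gcd.
- by rewrite weight_reroot // weight_redirect Gcd rc rcF /=; ring.
Qed.

(** If an exchange keeps the numbers of trees, minimality of [F] bounds [F'] from below, so [G'] is
    no heavier than [G] while its roots cover more of those of [F]. Iterating, the other kind of
    exchange must occur, and minimality of [F] is then applied to the forest [G'] that it
    produces. *)
Lemma forest_augment k F G : forest_in k.+1 F -> forest_in k G ->
  (forall F', forest_in k.+1 F' -> weight f l F <= weight f l F') ->
  exists c d, [/\ root_of F c <> root_of F d, e c d &
    weight f l F + f c d - l (root_of F c) <= weight f l G].
Proof.
move=> FP GP Fmin; have [n] := ubnP #|roots F :\: roots G|.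
elim: n G GP => // n IH G GP ltn.
case: (forest_exchange FP GP) => [[c [d [G' [[cd ecd G'P _ _] wE]]]]|].
  by exists c, d; split=> //; have := Fmin _ G'P; rewrite wE; lra.
move=> [F' [G' [F'P G'P wE _ ltG]]].
have [|c [d [cd ecd wle]]] := IH G' G'P; first exact: leq_trans ltG _.
by exists c, d; split=> //; have := Fmin _ F'P; lra.
Qed.

(** The dual induction, in which [F] moves towards [G] without gaining weight. In the last exchange
    the merge of [F] along [(c, d)] competes with the minimum [G], which makes [G'] no heavier than
    the current [F]. *)
Lemma forest_split k F G : forest_in k.+1 F -> forest_in k G ->
  (forall G', forest_in k G' -> weight f l G <= weight f l G') ->
  exists c d G', [/\ e c d, forest_in k.+1 G', root_of G' c <> root_of G' d,
    G =1 rerooted G' c (Some d) & weight f l G' <= weight f l F].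
Proof.
move=> FP GP Gmin; have [n] := ubnP #|roots F :\: roots G|.
elim: n F FP => // n IH F FP ltn.
case: (forest_exchange FP GP) => [[c [d [G' [[cd ecd G'P cd' GE] wE]]]]|].
  exists c, d, G'; split=> //.
  have := Gmin _ (forest_in_reroot_some FP cd ecd).
  rewrite weight_reroot /=; [|exact: fC|by have [] := FP|by move=> ? [<-]; exact/nesym].
  rewrite wE; lra.
move=> [F' [G' [F'P G'P wE ltF _]]].
have [|c [d [G'' [ecd G''P cd' GE wle]]]] := IH F' F'P; first exact: leq_trans ltF _.
by exists c, d, G''; split=> //; have := Gmin _ G'P; lra.
Qed.

End Exchange.

(** * Digraphs of successor functions *)

Section ForestDigraphs.
Variable T : finType.
Implicit Types (s : T -> option T) (C : {set T}) (i j : T).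

(** Arcs are not cut down to [C], so that [s] can be recovered from the digraph; [closed_under]
    states separately that they lie inside [C]. *)
Definition forest_digraph C s : digraph T :=
  Digraph C [set a | s a.1 == Some a.2].

Lemma eq_forest_digraph C s t : s =1 t -> forest_digraph C s = forest_digraph C t.
Proof. by move=> st; congr Digraph; apply/setP => a; rewrite !inE st. Qed.

Lemma has_arc_forest_digraph C s i j :
  has_arc (forest_digraph C s) i j = (s i == Some j).
Proof. by rewrite /has_arc inE. Qed.

Lemma has_edge_forest_digraph C s : has_edge (forest_digraph C s) =2 linked s.
Proof. by move=> i j; rewrite /has_edge !has_arc_forest_digraph. Qed.

Lemma forest_digraph_inj C s t : forest_digraph C s = forest_digraph C t -> s =1 t.
Proof.
move=> E i; have st j : (s i == Some j) = (t i == Some j).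
  by rewrite -!(has_arc_forest_digraph C) E.
case Es: (s i) => [j|]; first by apply/esym/eqP; rewrite -st Es.
by case Et: (t i) => [j|//]; have := st j; rewrite Es Et eqxx.
Qed.

Lemma component_forest_digraph C s i : acyclic s ->
  component (forest_digraph C s) i = [set j in C | root_of s i == root_of s j].
Proof.
move=> ac; apply/setP => j; rewrite !inE /= -connect_linked //.
by rewrite (eq_connect (@has_edge_forest_digraph C s)).
Qed.

Lemma root_set_forest_digraph C s :
  root_set (forest_digraph C s) = [set i in C | s i == None].
Proof.
apply/setP => i; rewrite !inE /=; congr (_ && _); apply/forallP/eqP => [H|si j].
  by case E: (s i) => [j|] //; have := H j; rewrite has_arc_forest_digraph E eqxx.
by rewrite has_arc_forest_digraph si.
Qed.

Definition closed_under s C := forall i j, s i = Some j -> i \in C /\ j \in C.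

Lemma entering_forest_digraph C s : acyclic s -> closed_under s C ->
  entering_forest (forest_digraph C s).
Proof.
move=> ac cl; split.
- by move=> i j; rewrite has_arc_forest_digraph => /eqP/cl[-> ->].
- by move=> i j j'; rewrite !has_arc_forest_digraph => /eqP-> /eqP[].
move=> [//|x c] /andP[cyc _]; exfalso.
have arc y : y \in x :: c -> s y = Some (next (x :: c) y).
  move=> yc; apply/eqP; rewrite -(has_arc_forest_digraph C).
  exact: next_cycle cyc yc.
(* A walk that stays on a cycle never reaches a root, whereas [#|T|] iterations do. *)
suff : forall n, iter n (up s) x \in x :: c.
  by move/(_ #|T|) => /arc; rewrite -/(root_of s x) ac.
elim=> [|n IH]; first by rewrite inE eqxx.
rewrite iterS; set j := iter n _ _ in IH *.
have -> : up s j = next (x :: c) j by rewrite /up (arc _ IH).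
by rewrite mem_next.
Qed.

(** [s] picks the unique head of the arc leaving each vertex. A walk of [s] that met no root would
    eventually loop, and the loop would be a directed cycle of [H]. *)
Lemma entering_forestP H : entering_forest H ->
  exists s, [/\ acyclic s, closed_under s (vertices H)
              & H = forest_digraph (vertices H) s].
Proof.
case=> wf fn nocyc; pose s i := [pick j | has_arc H i j].
have sE i j : has_arc H i j = (s i == Some j).
  rewrite /s; case: pickP => [k ik|/(_ j) ->//].
  by apply/idP/eqP => [ij|[<-]//]; rewrite (fn _ _ _ ik ij).
exists s; split.
- apply: acyclicP => i; suff: [exists n : 'I_#|T|.+1, s (iter n (up s) i) == None].
    by case/existsP => n /eqP; exists n.
  apply: contraT => /existsPn nn.
  have some n : s (iter n (up s) i) != None.
    apply/negP => /eqP sn; have := nn (Ordinal (ltnSn #|T|)).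
    by rewrite -/(root_of s i) (reaches_none sn).
  (* The walk comes back to its [m]-th vertex [x], so the orbit of [x] is a cycle of [up s]; as the
     walk meets no root, every step of this cycle is an arc. *)
  have /trajectP[m lem Em] := looping_order (up s) i.
  set x := iter m (up s) i in Em.
  have cyc : fcycle (up s) (orbit (up s) x).
    apply/(orbitPcycle 0 3); exists (order (up s) i - m).-1.
    by rewrite prednK ?subn_gt0 // /x -iterD subnK // ltnW.
  suff /nocyc ox : ucycle (has_arc H) (orbit (up s) x).
    by have := in_orbit (up s) x; rewrite ox.
  rewrite /ucycle orbit_uniq andbT; apply: (sub_in_cycle (P := [in orbit (up s) x]) _ _ cyc);
    last exact/allP.
  move=> y z; rewrite unfold_in -fconnect_orbit => /iter_findex <- _ /eqP <-.
  rewrite sE /up /x -iterD; case E: (s _) => //.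
  by have := some (findex (up s) x y + m); rewrite E.
- by move=> i j /eqP; rewrite -sE => /wf/andP[].
case: H {wf fn nocyc} s sE => C A s sE; congr Digraph; apply/setP => -[i j].
by rewrite inE -sE.
Qed.

Lemma root_in_closed s C i : closed_under s C -> i \in C -> root_of s i \in C.
Proof.
move=> cl iC; rewrite /root_of; elim: #|T| => //= n IH.
set j := iter n _ _ in IH *; rewrite /up; case E: (s j) => [k|//].
by have [] := cl _ _ E.
Qed.

Lemma card_components_forest_digraph C s : acyclic s -> closed_under s C ->
  #|components (forest_digraph C s)| = #|[set i in C | s i == None]|.
Proof.
move=> ac cl; pose comp i := [set j in C | root_of s i == root_of s j].
have -> : components (forest_digraph C s) = comp @: [set i in C | s i == None].
  apply/setP => D; apply/imsetP/imsetP => /= -[i iC ->]; last first.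
    exists i; first by move: iC; rewrite inE => /andP[].
    by rewrite component_forest_digraph.
  exists (root_of s i); first by rewrite inE ac eqxx andbT root_in_closed.
  rewrite component_forest_digraph // /comp.
  by rewrite (root_of_none (ac i)).
rewrite card_in_imset // => i j; rewrite !inE => /andP[iC /eqP si] /andP[jC /eqP sj].
move/setP/(_ i); rewrite !inE iC eqxx /= => /esym/eqP.
by rewrite !root_of_none.
Qed.

Lemma component_setT s i : acyclic s ->
  component (forest_digraph setT s) i = tree_set s i.
Proof.
move=> ac; rewrite component_forest_digraph //; apply/setP => j.
by rewrite !inE eq_sym.
Qed.

Lemma root_set_setT s : root_set (forest_digraph setT s) = roots s.
Proof. by rewrite root_set_forest_digraph; apply/setP => i; rewrite !inE. Qed.

Definition restrict s C : T -> option T := fun i => if i \in C then s i else None.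

Lemma acyclic_restrict s C : acyclic s -> acyclic (restrict s C).
Proof.
move=> ac; apply: acyclicP; apply: (acyclic_ind ac) => [i si|i j sij [n IH]].
  by exists 0; rewrite /= /restrict si if_same.
have [iC|iC] := boolP (i \in C); last by exists 0; rewrite /= /restrict (negbTE iC).
by exists n.+1; rewrite iterSr {2}/up /restrict iC sij.
Qed.

Lemma tree_at_forest_digraph s y : acyclic s ->
  tree_at (forest_digraph setT s) y =
  forest_digraph (tree_set s y) (restrict s (tree_set s y)).
Proof.
move=> ac; rewrite /tree_at component_setT // /induced setTI; congr Digraph.
apply/setP => -[i j]; rewrite !inE /restrict inE /=.
case: (eqVneq (root_of s i)) => [ri|_] /=; last by rewrite andbF.
by case: eqP => //= sij; rewrite -ri (root_of_up ac sij) eqxx.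
Qed.

End ForestDigraphs.

Section LinkUnique.
Variable T : finType.
Implicit Types (s t : T -> option T) (a b i j : T).

(* Otherwise a path of t from a to b would survive the removal of the link
   (a, b) from t. *)
Lemma link_unique t s a b a' b' : acyclic t -> acyclic s ->
  (forall i j, linked s i j -> linked t i j) ->
  linked t a b -> linked t a' b' ->
  root_of s a = root_of s a' -> root_of s b = root_of s b' ->
  root_of s a <> root_of s b -> a = a' /\ b = b'.
Proof.
move=> act acs st; wlog tab : a b a' b' / t a = Some b => [W ab ab' ra rb nab|].
  have [/eqP tab|/eqP tba] := orP ab; first exact: W.
  have [|||||-> -> //] := W b a b' a' tba; rewrite 1?linkedC //.
  exact/nesym.
move=> _ ab' ra rb nab; suff /andP[/eqP -> /eqP ->] : (a == a') && (b == b') by [].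
apply: contraT => ne.
have none_out e : None = Some e -> root_of t e <> root_of t a by [].
pose t1 := redirect t a None.
have act1 : acyclic t1 by exact: acyclic_redirect.
have [_ nt1 _] := redirect_up act none_out tab.
have lk i j : linked t i j -> ~~ ((i == a) && (j == b)) -> ~~ ((i == b) && (j == a)) ->
    linked t1 i j.
  rewrite /linked /t1 /redirect; case: (eqVneq i a) => [->|ia];
    case: (eqVneq j a) => [->|ja]; rewrite ?tab ?(inj_eq Some_inj) ?(eq_sym b) ?andbT ?andbF /= => //.
  - by case: (a == b).
  - by case/orP=> // /eqP ->; rewrite eqxx.
  - by case/orP=> // /eqP ->; rewrite ?orbT ?eqxx.
have st1 i j : linked s i j -> linked t1 i j.
  move=> sij; have rij := root_of_linked acs sij.
  apply: lk (st _ _ sij) _ _; apply/negP => /andP[/eqP iE /eqP jE];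
    by apply: nab; rewrite -iE -jE rij.
have r1 i j : root_of s i = root_of s j -> root_of t1 i = root_of t1 j.
  exact: root_of_linked_sub.
case: nt1; rewrite (r1 _ _ ra) (r1 _ _ rb).
apply: root_of_linked => //; apply: lk => //.
  by rewrite [a' == _]eq_sym [b' == _]eq_sym.
apply/negP => /andP[/eqP aE /eqP bE].
by apply: nab; rewrite rb bE.
Qed.

End LinkUnique.

(** * Spanning forests of the barrier digraph, their merges and descendants *)

Section PotentialForests.
Variables (R : realType) (T : finType) (P : potential_graph R T).
Implicit Types (s t : T -> option T) (a b c d i j l x y : T) (k m : nat) (F H : digraph T).
Local Open Scope ring_scope.

(* Equal to the potential on edges, but symmetric everywhere. *)
Definition edge_weight i j : R := if edge P i j then potential P i j else 0.
Definition loop_weight i : R := potential P i i.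
Definition pweight s : R := weight edge_weight loop_weight s.
Definition pforest k s := forest_in (edge P) k s.
Definition optimal k s :=
  pforest k s /\ forall t, pforest k t -> pweight s <= pweight t.

Lemma edge_weightC i j : edge_weight i j = edge_weight j i.
Proof.
by rewrite /edge_weight edge_sym; case: ifP => // ji; rewrite (potential_sym ji).
Qed.

Lemma edge_weightE i j : edge P i j -> edge_weight i j = potential P i j.
Proof. by rewrite /edge_weight => ->. Qed.

Lemma acyclic_neq s i j : acyclic s -> s i = Some j -> i != j.
Proof.
move=> ac; have [h hP] := acyclic_rank ac => /hP; apply: contraTneq => ->.
by rewrite ltnn.
Qed.

Lemma spanning_forestP k F : spanning_forest P k F <->
  exists2 s, pforest k s & F = forest_digraph setT s.
Proof.
split=> [[ef /andP[_ sub] vF cF]|[s [ac es ks] ->]].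
  have [s [ac cl FE]] := entering_forestP ef; exists s; last by rewrite FE vF.
  split=> //.
    have es i j : s i = Some j -> edge P i j.
      move=> sij; have : (i, j) \in arcs F by rewrite FE inE sij eqxx.
      by move/(subsetP sub); rewrite inE => /andP[].
    by move=> i j /orP[]/eqP/es //; rewrite edge_sym.
  rewrite -cF FE vF card_components_forest_digraph //; apply: eq_card => i.
  by rewrite !inE.
have cl : closed_under s setT by move=> i j; rewrite !inE.
split.
- exact: entering_forest_digraph.
- rewrite /subgraph subsetT; apply/subsetP => -[i j]; rewrite !inE /= => /eqP sij.
  by rewrite (acyclic_neq ac sij) es // /linked sij eqxx.
- by [].
- by rewrite card_components_forest_digraph // -ks; apply: eq_card => i; rewrite !inE.
Qed.

(** A non-root pays [p_ij - p_ii] and a root pays [p_ii - p_ii], so the correction runs over all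
    vertices and is the same for every forest. *)
Lemma forest_weightE s : (forall i j, s i = Some j -> edge P i j) ->
  forest_weight P (forest_digraph setT s) = pweight s - \sum_i loop_weight i.
Proof.
move=> es; rewrite /pweight /weight -sumrB /forest_weight.
transitivity (\sum_(a | s a.1 == Some a.2) barrier P a.1 a.2).
  by apply: eq_bigl => a; rewrite inE.
rewrite -(pair_big_dep xpredT (fun i j => s i == Some j) (fun i j => barrier P i j)) /=.
apply: eq_bigr => i _; case E: (s i) => [j|] /=; last first.
  by rewrite big_pred0 ?subrr.
rewrite (big_pred1 j) => [|k]; last by rewrite /= (inj_eq Some_inj) eq_sym.
by rewrite /barrier edge_weightE //; exact: es.
Qed.

Lemma min_spanning_forestP k F : min_spanning_forest P k F <->
  exists2 s, optimal k s & F = forest_digraph setT s.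
Proof.
have wE s : pforest k s ->
    forest_weight P (forest_digraph setT s) = pweight s - \sum_i loop_weight i.
  by case=> ac es _; apply: forest_weightE => i j sij; apply: es; rewrite /linked sij eqxx.
split=> [[/spanning_forestP[s sP ->] smin]|[s [sP smin] ->]].
  exists s => //; split=> // t tP.
  have := smin (forest_digraph setT t); rewrite !wE // lerD2r; apply.
  by apply/spanning_forestP; exists t.
split=> [|G /spanning_forestP[t tP ->]]; first by apply/spanning_forestP; exists s.
by rewrite !wE // lerD2r smin.
Qed.

(** Prescribing edges and root leaves exactly one solution, the reversal of the path from [a]. One
    direction makes the reorientation used in any given step canonical, the other shows that a
    reorientation exists. *)
Lemma reorientationP s y a H : acyclic s -> s y = None -> root_of s a = y ->
  reorientation (tree_at (forest_digraph setT s) y) a H <->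
  H = forest_digraph (tree_set s y) (restrict (rerooted s a None) (tree_set s y)).
Proof.
move=> ac sy ra; set C := tree_set s y; set t := rerooted s a None.
have ry : root_of s y = y by exact: root_of_none.
have aC : a \in C by rewrite inE ra ry.
have act : acyclic t by exact: acyclic_reroot_none.
have linkC i j : linked s i j -> (i \in C) = (j \in C).
  by move/(root_of_linked ac) => rij; rewrite !inE rij.
(* [C] is a union of components of [u], so restricting to it cuts no link. *)
have lkr u : (forall i j, linked u i j -> (i \in C) = (j \in C)) -> forall i j,
    linked (restrict u C) i j = linked u i j && (i \in C).
  move=> uC i j; rewrite /restrict.
  case: (boolP (linked u i j)) => [uij|uij].
    by rewrite /linked -(uC _ _ uij); case: ifP.
  move: uij; rewrite /linked negb_or => /andP[/negbTE ui /negbTE uj].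
  by do 2 case: ifP => _; rewrite ?ui ?uj.
have tC i j : linked t i j -> (i \in C) = (j \in C).
  by rewrite linked_reroot_none //; exact: linkC.
have rtC i : (restrict t C i == None) = (i \notin C) || (i == a).
  rewrite /restrict; case: ifP => //= iC.
  have := roots_reroot_none a ac => /setP/(_ i); rewrite !inE -/t => ->.
  case: (eqVneq i a) => //= _; rewrite ra; apply/negbTE; rewrite negb_and negbK.
  move: iC; rewrite inE ry => /eqP ri; case: (eqVneq i y) => //= iy.
  by apply: contra_neq iy => /root_of_none <-.
have clt : closed_under (restrict t C) C.
  move=> i j; rewrite /restrict; case: ifP => // iC tij.
  by rewrite -(tC i j) ?iC // /linked tij eqxx.
have cls : closed_under (restrict s C) C.
  move=> i j; rewrite /restrict; case: ifP => // iC sij.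
  by rewrite -(linkC i j) ?iC // /linked sij eqxx.
have actr : acyclic (restrict t C) by exact: acyclic_restrict.
have rootsE : [set i in C | restrict t C i == None] = [set a].
  apply/setP => i; rewrite !inE rtC inE; case: (eqVneq i a) => [->|ia].
    by rewrite orbT ra ry eqxx.
  by rewrite orbF andbN.
have edges : linked (restrict t C) =2 linked (restrict s C).
  by move=> i j; rewrite !lkr // linked_reroot_none.
rewrite tree_at_forest_digraph // -/C; split=> [[vH eH [fH _] rH]|->].
  have [u [acu clu HE]] := entering_forestP fH.
  rewrite HE vH; apply: eq_forest_digraph; apply: eq_linked_roots => //.
    move=> i j; rewrite edges -(has_edge_forest_digraph (vertices H)) -HE eH.
    exact: has_edge_forest_digraph.
  move=> i; rewrite rtC; move: rH; rewrite HE vH root_set_forest_digraph /= => /setP/(_ i).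
  rewrite in_set1 !inE; have [iC|iC] := boolP (root_of s i == root_of s y); first by [].
  move=> _; case E: (u i) => [j|//].
  by have [] := clu _ _ E; rewrite vH /= inE (negbTE iC).
split=> //.
- by move=> i j; rewrite !has_edge_forest_digraph edges.
- split; first exact: entering_forest_digraph.
  by rewrite card_components_forest_digraph // rootsE cards1.
- by rewrite root_set_forest_digraph.
Qed.

Lemma restrict_reroot_some s a b : acyclic s -> root_of s a <> root_of s b ->
  forall i, i \in tree_set s a -> i != a ->
  rerooted s a (Some b) i = restrict (rerooted s a None) (tree_set s a) i.
Proof.
move=> ac nab i iC ia.
by rewrite /restrict iC -redirect_reroot_none // redirect_other.
Qed.

Lemma mergedP s y a b F : acyclic s -> s y = None -> root_of s a = y ->
  root_of s b <> y ->
  merged (forest_digraph setT s) y a b F <->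
  F = forest_digraph setT (rerooted s a (Some b)).
Proof.
move=> ac sy ra rb; have ry : root_of s y = y by exact: root_of_none.
have CE : tree_set s y = tree_set s a by rewrite /tree_set ra ry.
have nab : root_of s a <> root_of s b by rewrite ra; exact/nesym.
suff arcsE : Digraph [set: T]
    ((arcs (forest_digraph setT s) :\: arcs (tree_at (forest_digraph setT s) y))
     :|: arcs (forest_digraph (tree_set s y) (restrict (rerooted s a None) (tree_set s y)))
     :|: [set (a, b)]) = forest_digraph setT (rerooted s a (Some b)).
  split=> [[H /(reorientationP _ ac sy ra) -> ->]|->]; first exact: arcsE.
  by eexists; [apply/(reorientationP _ ac sy ra)|exact: esym arcsE].
congr Digraph; apply/setP => -[i j]; rewrite tree_at_forest_digraph // CE !inE /=.
rewrite xpair_eqE; have [->|ia] := eqVneq i a.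
  rewrite reroot_some_same // (inj_eq Some_inj) /restrict inE eqxx.
  by rewrite reroot_none_same // [j == b]eq_sym /=; case: (s a == _).
rewrite orbF; have [iC|iC] := boolP (i \in tree_set s a).
  rewrite restrict_reroot_some // {1}/restrict iC.
  by case: (s i == _) => /=.
rewrite /restrict (negbTE iC) orbF /= reroot_some_other //.
by move: iC; rewrite inE => /eqP.
Qed.

Lemma descendant_reroot k s c d : pforest k.+1 s -> root_of s c <> root_of s d ->
  edge P c d ->
  descendant P k.+1 (forest_digraph setT (rerooted s c (Some d))) (forest_digraph setT s).
Proof.
move=> sP cd ecd; have [ac es ks] := sP.
have tP : pforest k (rerooted s c (Some d)).
  by apply: forest_in_reroot_some => //; exact: edge_sym.
split.
- by apply/spanning_forestP; exists (rerooted s c (Some d)).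
- by apply/spanning_forestP; exists s.
set y := root_of s c; have sy : s y = None by exact: ac.
have ry : root_of s y = y by exact: root_of_none.
exists y; first by rewrite root_set_setT inE sy.
have rd : root_of s d <> y by exact/nesym.
split.
- by rewrite !root_set_setT roots_reroot_some.
- move=> q; rewrite root_set_setT roots_reroot_some // !inE => /andP[/eqP qy /eqP sq].
  rewrite /tree_at /induced component_setT //; congr Digraph.
  apply/setP => -[i j]; rewrite !inE /=; case: (eqVneq (root_of s i)) => [ri|_] /=; last by rewrite !andbF.
  by rewrite reroot_some_other // ri (root_of_none sq) => /qy.
have -> : induced (forest_digraph setT (rerooted s c (Some d)))
    (component (forest_digraph setT s) y) =
    forest_digraph (tree_set s y) (restrict (rerooted s c None) (tree_set s y)).
  rewrite /induced component_setT // setTI; congr Digraph.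
  apply/setP => -[i j]; rewrite !inE /=; have CE : tree_set s y = tree_set s c.
    by rewrite /tree_set ry.
  rewrite !CE ry /restrict !inE; case: (eqVneq (root_of s i)) => [ri|_] /=; last by rewrite andbF.
  have [->|ic] := eqVneq i c.
    (* The added arc [(c, d)] is not in the induced subgraph, since [d] lies in another tree. *)
    rewrite reroot_some_same // reroot_none_same //=.
    by apply/negbTE/negP => /andP[/eqP[<-] /eqP].
  rewrite -redirect_reroot_none // redirect_other //; case: eqP => //= tij.
  apply/eqP; rewrite -ri; apply/esym/eqP.
  rewrite -(root_of_linked_eq i j (acyclic_reroot_none c ac) ac (linked_reroot_none c ac)).
  by rewrite (root_of_up _ tij) //; exact: acyclic_reroot_none.
by case: ((reorientationP _ ac sy (erefl y)).2 (erefl _)).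
Qed.

End PotentialForests.

(** * Runs of the procedure *)

Section Runs.
Variables (R : realType) (T : finType) (P : potential_graph R T).
Implicit Types (s t : T -> option T) (a b c d i j l x y : T) (k m : nat).
Implicit Types (st : state R T) (keep : T -> bool).
Local Open Scope ring_scope.

Local Notation pot i j := (potential P i j)%:E.

Definition realized st s l i := exists a b,
  [/\ orig st l i = Some (a, b), root_of s a = l, root_of s b = i,
      edge P a b & pmat st l i = pot a b].

(** Together, [inv_lower] and [inv_realized] make [pmat l i] the minimum potential of an edge
    joining the trees of [l] and [i], infinite if there is none. Entries with an index that is no
    longer a root are stale and unconstrained. [inv_loop] serves the program, which reads loop
    weights from its own table. *)
Record invariant st s : Prop := Invariant {
  inv_forest : forest st = forest_digraph setT s;
  inv_acyclic : acyclic s;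
  inv_loop : forall l, l \in roots s -> pmat st l l = pot l l;
  inv_vmat : forall l i, l \in roots s -> i \in roots s -> l != i ->
    vmat st l i = (pmat st l i - pot l l)%E;
  inv_lower : forall a b, edge P a b -> root_of s a <> root_of s b ->
    (pmat st (root_of s a) (root_of s b) <= pot a b)%E;
  inv_realized : forall l i, l \in roots s -> i \in roots s -> l != i ->
    pmat st l i = +oo%E \/ realized st s l i }.

Lemma inv_root_set st s : invariant st s -> root_set (forest st) = roots s.
Proof. by move=> I; rewrite (inv_forest I) root_set_setT. Qed.

(** A path of [P] between two roots must change trees. This is where connectivity enters: some entry
    stays finite while two trees remain. *)
Lemma edge_across s y x : acyclic s -> y \in roots s -> x \in roots s -> y != x ->
  exists c d, edge P c d /\ root_of s c <> root_of s d.
Proof.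
move=> ac yK xK yx.
suff /existsP[c /existsP[d /andP[ecd /eqP cd]]] :
    [exists c, exists d, edge P c d && (root_of s c != root_of s d)].
  by exists c, d.
apply: contraT => /existsPn nE; case/eqP: yx; move: yK xK; rewrite !inE => /eqP sy /eqP sx.
have rE c d : edge P c d -> root_of s c = root_of s d.
  by move=> ecd; apply/eqP; have /existsPn/(_ d) := nE c; rewrite ecd negbK.
rewrite -(root_of_none sx) -(root_of_none sy).
have /connectP[p yp ->] := edge_connected P y x.
elim: p y yp {sy} => //= z p IH y /andP[eyz zp].
by rewrite (rE _ _ eyz); exact: IH.
Qed.

Lemma roots_two s : (1 < #|roots s|)%N ->
  exists y x, [/\ y \in roots s, x \in roots s & y != x].
Proof. by move/card_gt1P => [y [x [yK xK yx]]]; exists y, x. Qed.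

Lemma min_pair_exists st s : invariant st s -> (1 < #|roots s|)%N ->
  exists y x, min_pair st y x.
Proof.
move=> I /roots_two[y [x [yK xK yx]]].
pose Q (p : T * T) := [&& p.1 \in roots s, p.2 \in roots s & p.1 != p.2].
have Q0 : Q (y, x) by rewrite /Q yK xK yx.
pose q := [arg min_(p < (y, x) | Q p) vmat st p.1 p.2]%O.
have : Q q /\ forall p, Q p -> (vmat st q.1 q.2 <= vmat st p.1 p.2)%E.
  by rewrite /q; case: Order.TotalTheory.arg_minP => // p Qp pmin.
case=> /and3P[q1 q2 q12] qmin; exists q.1, q.2; rewrite /min_pair (inv_root_set I).
by split=> // l i lK iK li; apply: (qmin (l, i)); rewrite /Q lK iK li.
Qed.

(** Entries are minima over the edges between two trees, so the greedy pair yields the cheapest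
    merge over all edges between distinct trees. *)
Lemma min_pair_edge st s y x : invariant st s -> min_pair st y x ->
  exists a b, [/\ orig st y x = Some (a, b), root_of s a = y, root_of s b = x,
    edge P a b & forall c d, edge P c d -> root_of s c <> root_of s d ->
      potential P a b - potential P y y
        <= potential P c d - potential P (root_of s c) (root_of s c)].
Proof.
move=> I []; rewrite (inv_root_set I) => yK xK yx vmin.
have ac := inv_acyclic I.
have low c d : edge P c d -> root_of s c <> root_of s d ->
    (vmat st y x <= pot c d - pot (root_of s c) (root_of s c))%E.
  move=> ecd /eqP cd; apply: le_trans (vmin _ _ _ _ cd) _; rewrite ?roots_root_of //.
  rewrite (inv_vmat I) ?roots_root_of //; apply: leeB => //.
  by apply: (inv_lower I) => //; exact/eqP.
case: (inv_realized I yK xK yx) => [pE|[a [b [oE ra rb eab pE]]]].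
  (* An infinite minimum would contradict the finite bound [low] at an edge between two trees. *)
  have [c [d [ecd cd]]] := edge_across ac yK xK yx.
  by have := low _ _ ecd cd; rewrite (inv_vmat I) // pE.
exists a, b; split=> // c d ecd cd; have := low _ _ ecd cd.
by rewrite (inv_vmat I) // pE -!EFinB lee_fin.
Qed.

Section Update.
Variables (st : state R T) (y x : T) (keep : T -> bool).

Definition entry_update (A : Type) (M : T -> T -> A) (col row : T -> A) : T -> T -> A :=
  fun l i => if (i == x) && (l != x) then col l
             else if (l == x) && (i != x) then row i else M l i.

(** [keep l] tells which of the entries [(l, x)] and [(l, y)] supplies both the new value and its
    recorded edge; it carries all the freedom left by ties. *)
Definition merged_pmat l := pmat st l (if keep l then x else y).
Definition merged_orig l := orig st l (if keep l then x else y).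

Definition updated_state F : state R T :=
  State F
    (entry_update (pmat st) merged_pmat merged_pmat)
    (entry_update (vmat st) (fun l => merged_pmat l - pot l l)%E
                            (fun i => merged_pmat i - pot x x)%E)
    (entry_update (orig st) merged_orig (fun i => omap (@swap T) (merged_orig i))).

Definition keep_min (K : {set T}) := forall l, l \in K -> l != x ->
  if keep l then (pmat st l x <= pmat st l y)%E else (pmat st l y <= pmat st l x)%E.

Lemma merged_pmat_min K l : keep_min K -> l \in K -> l != x ->
  merged_pmat l = Order.min (pmat st l x) (pmat st l y).
Proof.
move=> km lK lx; move: (km _ lK lx); rewrite /merged_pmat.
by case: (keep l) => [/min_l|/min_r].
Qed.

End Update.

Definition agree (K : {set T}) st st' := forall l i, l \in K -> i \in K ->
  [/\ pmat st' l i = pmat st l i, vmat st' l i = vmat st l i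
    & orig st' l i = orig st l i].

Lemma updatedP st y x st' : let K' := root_set (forest st) :\ y in x \in K' ->
  updated P st y x st' <-> exists2 keep, keep_min st y x keep K' &
    agree K' (updated_state st y x keep (forest st')) st'.
Proof.
move=> K' xK'; split=> [[U1 U2]|[keep km ag]]; last first.
  split=> [l lK' lx|l i lK' iK' lxi].
    have [p1 v1 o1] := ag l x lK' xK'; have [p2 v2 o2] := ag x l xK' lK'.
    move: p1 v1 o1 p2 v2 o2; rewrite /= /entry_update eqxx lx (negbTE lx) /=.
    move=> p1 v1 o1 p2 v2 o2; split.
    - by rewrite p1 (merged_pmat_min km).
    - by rewrite p1 p2.
    - move: (km _ lK' lx); rewrite o1 /merged_orig.
      by case: (keep l); [left|right].
    - by rewrite o1 o2.
    - by rewrite v1 v2 p1.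
  have [-> -> ->] := ag l i lK' iK'; rewrite /= /entry_update lxi.
  by case: (i == x).
(* Without a tie [updated] forces the recorded edge, so the test on [orig] decides only when the two
   entries are equal. *)
pose keep l := (pmat st l x <= pmat st l y)%E && (orig st' l x == orig st l x).
have kP l : l \in K' -> l != x ->
    [/\ if keep l then (pmat st l x <= pmat st l y)%E else (pmat st l y <= pmat st l x)%E,
        pmat st' l x = merged_pmat st y x keep l &
        orig st' l x = merged_orig st y x keep l].
  move=> lK' lx; have [-> _ oE _ _] := U1 l lK' lx.
  rewrite /merged_pmat /merged_orig; case: ifP => [/andP[le /eqP ->]|].
    by rewrite (min_l le).
  case: oE => [[le oE]|[le -> _]]; first by rewrite /keep le oE eqxx.
  by rewrite (min_r le).
exists keep => [l lK' lx|l i lK' iK']; first by have [] := kP l lK' lx.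
rewrite /= /entry_update; case: (eqVneq i x) iK' => [-> _|ix iK'].
  case: (eqVneq l x) lK' => [-> _|lx lK'] /=; first exact: U2.
  have [_ pE oE] := kP l lK' lx; have [_ _ _ _ [-> _]] := U1 l lK' lx.
  by rewrite pE oE.
case: (eqVneq l x) lK' => [-> _|lx lK'] /=; last first.
  by apply: U2; rewrite // (negbTE lx) (negbTE ix).
have [_ pE oE] := kP i iK' ix; have [_ -> _ -> [_ ->]] := U1 i iK' ix.
by rewrite pE oE.
Qed.

Section InvariantStep.
Variables (st st' : state R T) (s : T -> option T) (a b : T) (keep : T -> bool).
Let y := root_of s a.
Let x := root_of s b.
Let t := rerooted s a (Some b).
Hypotheses (I : invariant st s) (yx : y <> x)
  (km : keep_min st y x keep (roots t))
  (fE : forest st' = forest_digraph setT t)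
  (ag : agree (roots t) (updated_state st y x keep (forest st')) st').

Let ac : acyclic s. Proof. exact: inv_acyclic I. Qed.

Lemma roots_step : roots t = roots s :\ y.
Proof. by rewrite roots_reroot_some. Qed.

Lemma root_of_step i : root_of t i = if root_of s i == y then x else root_of s i.
Proof. by rewrite root_of_reroot_some. Qed.

Let xK : x \in roots s. Proof. exact: roots_root_of. Qed.
Let yK : y \in roots s. Proof. exact: roots_root_of. Qed.

Lemma agree_step_other l i : l \in roots t -> i \in roots t -> (l == x) = (i == x) ->
  [/\ pmat st' l i = pmat st l i, vmat st' l i = vmat st l i
    & orig st' l i = orig st l i].
Proof.
move=> lK iK li; have [-> -> ->] := ag lK iK; rewrite /= /entry_update li.
by case: (i == x).
Qed.

Lemma agree_step_col l : l \in roots t -> l != x ->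
  [/\ pmat st' l x = merged_pmat st y x keep l,
      vmat st' l x = (pmat st' l x - pot l l)%E
    & orig st' l x = merged_orig st y x keep l].
Proof.
move=> lK lx; have xt : x \in roots t.
  by rewrite roots_step in_setD1 xK andbT; apply/eqP/nesym.
by have [-> -> ->] := ag lK xt; rewrite /= /entry_update eqxx lx.
Qed.

Lemma agree_step_row i : i \in roots t -> i != x ->
  [/\ pmat st' x i = merged_pmat st y x keep i,
      vmat st' x i = (pmat st' x i - pot x x)%E
    & orig st' x i = omap (@swap T) (merged_orig st y x keep i)].
Proof.
move=> iK ix; have xt : x \in roots t.
  by rewrite roots_step in_setD1 xK andbT; apply/eqP/nesym.
by have [-> -> ->] := ag xt iK; rewrite /= /entry_update eqxx ix (negbTE ix).
Qed.

Lemma merged_realized l : l \in roots t -> l != x ->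
  merged_pmat st y x keep l = +oo%E \/ exists c d,
    [/\ merged_orig st y x keep l = Some (c, d), root_of t c = l, root_of t d = x,
        edge P c d & merged_pmat st y x keep l = pot c d].
Proof.
rewrite roots_step !inE => /andP[ly lK] lx; rewrite /merged_pmat /merged_orig.
set z := if keep l then x else y.
have zK : z \in roots s by rewrite /z; case: (keep l).
have lz : l != z by rewrite /z; case: (keep l).
have lK' : l \in roots s by rewrite inE.
case: (inv_realized I lK' zK lz) => [->|[c [d [oE rc rd ecd pE]]]]; [by left|right].
exists c, d; rewrite !root_of_step rc rd (negbTE ly); split=> //.
by rewrite /z; case: (keep l); rewrite ?eqxx //; case: ifP.
Qed.

Lemma invariant_step : invariant st' t.
Proof.
have act : acyclic t by apply: acyclic_reroot_some => //; exact: yx.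
have sub l : l \in roots t -> l \in roots s by rewrite roots_step => /setD1P[].
split=> //.
- move=> l lK; have [-> _ _] := agree_step_other lK lK erefl.
  exact/(inv_loop I)/sub.
- move=> l i lK iK li; case: (eqVneq i x) => [ix|ix].
    by move: li iK; rewrite ix => lx _; have [_ -> _] := agree_step_col lK lx.
  case: (eqVneq l x) => [lx|lx].
    by rewrite lx; have [_ -> _] := agree_step_row iK ix.
  have [-> -> _] := agree_step_other lK iK (etrans (negbTE lx) (esym (negbTE ix))).
  by apply: (inv_vmat I) => //; exact: sub.
(* An edge into the merged tree ends in the old tree of [x] or of [y], and the new entry is the
   minimum of the two old bounds. *)
- have col c d : edge P c d -> root_of t c != x -> root_of t d = x ->
      (merged_pmat st y x keep (root_of t c) <= pot c d)%E.
    move=> ecd cx dx; have cK := roots_root_of c act.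
    rewrite (merged_pmat_min km cK cx) ge_min.
    move: cx dx; rewrite !root_of_step; case: (eqVneq (root_of s c) y) => [|cy cx].
      by rewrite eqxx.
    case: (eqVneq (root_of s d) y) => [dy _|_ dx].
      by rewrite -[in X in _ || X]dy (inv_lower I) ?orbT // dy; exact/eqP.
    by rewrite -[in X in X || _]dx (inv_lower I) // dx; exact/eqP.
  move=> c d ecd cd; have cK := roots_root_of c act; have dK := roots_root_of d act.
  have [dx|dx] := eqVneq (root_of t d) x.
    have cx : root_of t c != x by rewrite -dx; exact/eqP.
    by rewrite dx; have [-> _ _] := agree_step_col cK cx; exact: col.
  have [cx|cx] := eqVneq (root_of t c) x.
    rewrite cx; have [-> _ _] := agree_step_row dK dx.
    by rewrite (potential_sym ecd); apply: col => //; rewrite edge_sym.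
  have [-> _ _] := agree_step_other cK dK (etrans (negbTE cx) (esym (negbTE dx))).
  move: cx dx cd; rewrite !root_of_step.
  case: (eqVneq (root_of s c) y) => [|_]; rewrite ?eqxx //.
  case: (eqVneq (root_of s d) y) => [|_]; rewrite ?eqxx // => _ _.
  exact: (inv_lower I).
- move=> l i lK iK li; have [ix|ix] := eqVneq i x.
    have lx : l != x by rewrite -ix.
    rewrite ix; have [pE _ oE] := agree_step_col lK lx; rewrite /realized pE oE.
    exact: merged_realized.
  have [lx|lx] := eqVneq l x.
    rewrite lx; have [pE _ oE] := agree_step_row iK ix; rewrite /realized pE oE.
    case: (merged_realized iK ix) => [->|[c [d [-> rc rd ecd ->]]]]; [by left|right].
    exists d, c; rewrite (potential_sym ecd) edge_sym; split=> //.
  have [pE _ oE] := agree_step_other lK iK (etrans (negbTE lx) (esym (negbTE ix))).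
  rewrite /realized pE oE; case: (inv_realized I (sub _ lK) (sub _ iK) li) => [->|[c [d [oE' rc rd ecd ->]]]]; [by left|right].
  exists c, d; rewrite !root_of_step rc rd; split=> //.
    by move: lK; rewrite roots_step !inE => /andP[/negbTE ->].
  by move: iK; rewrite roots_step !inE => /andP[/negbTE ->].
Qed.

End InvariantStep.

End Runs.

(** * Optimality of runs, and reachability of every minimum forest *)

Section Optimality.
Variables (R : realType) (T : finType) (P : potential_graph R T).
Implicit Types (s t : T -> option T) (a b c d i j l x y : T) (k m : nat).
Implicit Types (st : state R T) (keep : T -> bool) (S : nat -> state R T).
Local Open Scope ring_scope.

Local Notation pot i j := (potential P i j)%:E.

Lemma updated_state_step st s y x a b keep : invariant P st s -> min_pair st y x ->
  orig st y x = Some (a, b) -> keep_min st y x keep (roots s :\ y) ->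
  step P st (updated_state P st y x keep (forest_digraph setT (rerooted s a (Some b)))).
Proof.
move=> I mp oE km; have [a' [b' [oE' ra rb _ _]]] := min_pair_edge I mp.
move: oE'; rewrite oE => -[aE bE]; rewrite -{}aE in ra; rewrite -{}bE in rb.
have [+ + yx _] := mp; rewrite (inv_root_set I) => yK xK.
exists y, x, a, b; split=> //.
  rewrite (inv_forest I); apply/mergedP => //.
  - exact: inv_acyclic I.
  - by apply/eqP; rewrite inE in yK.
  - by rewrite rb; apply/eqP; rewrite eq_sym.
apply/updatedP; rewrite (inv_root_set I) ?in_setD1 1?eq_sym ?yx //.
by exists keep.
Qed.

Lemma step_exists st s : invariant P st s -> (1 < #|roots s|)%N ->
  exists st', step P st st'.
Proof.
move=> I /(min_pair_exists I)[y [x mp]].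
have [a [b [oE _ _ _ _]]] := min_pair_edge I mp.
eexists; apply: (updated_state_step (keep := fun l => (pmat st l x <= pmat st l y)%E) I mp oE).
by move=> l _ _; case: ifP => // /negbT; rewrite -ltNge => /ltW.
Qed.

Lemma step_invariant st st' s : invariant P st s -> step P st st' -> exists a b,
  [/\ root_of s a <> root_of s b, edge P a b,
      invariant P st' (rerooted s a (Some b)) &
      forall c d, edge P c d -> root_of s c <> root_of s d ->
      potential P a b - potential P (root_of s a) (root_of s a)
        <= potential P c d - potential P (root_of s c) (root_of s c)].
Proof.
move=> I [y [x [a [b [mp oE mg up]]]]].
have [a' [b' [oE' ra rb eab low]]] := min_pair_edge I mp.
move: oE'; rewrite oE => -[aE bE].
rewrite -{}aE -{}bE in ra rb eab low.
have [+ + /eqP yx _] := mp; rewrite (inv_root_set I) => yK xK.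
have nab : root_of s a <> root_of s b by rewrite ra rb.
have ac := inv_acyclic I.
have rtE : roots (rerooted s a (Some b)) = roots s :\ y by rewrite roots_reroot_some // ra.
have fE : forest st' = forest_digraph setT (rerooted s a (Some b)).
  apply/(@mergedP _ s y) => //.
  - by apply/eqP; rewrite inE in yK.
  - by rewrite rb; exact/nesym.
  - by rewrite -(inv_forest I).
exists a, b; split=> //; last by rewrite ra.
move: up => /updatedP; rewrite (inv_root_set I) in_setD1 xK andbT.
move=> /(_ (introN eqP (nesym yx))) [keep km ag].
by have := @invariant_step _ _ _ _ st' _ a b keep I nab; rewrite ra rb rtE; apply.
Qed.

(** [forest_augment] gives a merge of [s] no heavier than a competitor [t], and the greedy merge is
    no heavier than that one. *)
Lemma optimal_step m s a b : optimal P m.+1 s -> root_of s a <> root_of s b ->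
  edge P a b -> (forall c d, edge P c d -> root_of s c <> root_of s d ->
      potential P a b - potential P (root_of s a) (root_of s a)
        <= potential P c d - potential P (root_of s c) (root_of s c)) ->
  optimal P m (rerooted s a (Some b)).
Proof.
move=> [sP smin] nab eab low; have [ac _ _] := sP; split.
  by apply: forest_in_reroot_some => //; exact: edge_sym.
move=> t tP.
have [c [d [ncd ecd]]] := forest_augment (@edge_weightC _ _ P) sP tP smin.
rewrite /pweight weight_reroot //=; [|exact: edge_weightC|by move=> e [<-]; exact/nesym].
rewrite !edge_weightE //; apply: le_trans; rewrite -/(pweight P s).
by have := low _ _ ecd ncd; rewrite /loop_weight; lra.
Qed.

Lemma initial_optimal : optimal P #|T| (fun _ => None).
Proof.
have uniq_forest t : pforest P #|T| t -> (fun _ => None) =1 t.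
  case=> _ _ ct i; apply/esym/eqP; have : i \in roots t; last by rewrite inE.
  have /eqP -> : roots t == setT by rewrite eqEcard subsetT cardsT ct leqnn.
  by rewrite inE.
split=> [|t /uniq_forest tE]; last by rewrite /pweight (eq_weight _ _ tE).
split=> //; apply: eq_card => i; rewrite !inE //.
Qed.

Lemma initial_invariant : invariant P (initial_state P) (fun _ => None).
Proof.
have rE i : root_of (fun _ : T => None) i = i by exact: root_of_none.
split=> //=.
- by move=> l _; rewrite /potential_matrix edge_loop.
- move=> l i _ _ li; rewrite /barrier_matrix /potential_matrix li /=.
  by case: ifP => // _; rewrite /barrier EFinB.
- by move=> a b ab _; rewrite !rE /potential_matrix ab.
- move=> l i _ _ li; rewrite /realized /= /potential_matrix.
  by case: ifP => eli; [right; exists l, i; rewrite !rE|left].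
Qed.

Lemma run_invariant k S : partial_run P k S -> (0 < k)%N ->
  forall m, (k <= m <= #|T|)%N -> exists2 s, invariant P (S m) s & optimal P m s.
Proof.
move=> [S0 SS] k0 m /andP[km mN].
(* Stages decrease, so the induction is on the distance from the initial stage. *)
rewrite -(subKn mN); have: (#|T| - m <= #|T| - k)%N by exact: leq_sub2l.
elim: (#|T| - m)%N => [|j IH] jk.
  rewrite subn0 S0; exists (fun _ => None); [exact: initial_invariant|exact: initial_optimal].
have [|s I sO] := IH; first exact: ltnW.
have jE : (#|T| - j = (#|T| - j.+1).+1)%N.
  by rewrite subnSK //; apply: leq_trans jk (leq_subr _ _).
have kj : (k < #|T| - j <= #|T|)%N.
  by rewrite leq_subr andbT ltn_subRL addnC -ltn_subRL.
have := SS _ kj; rewrite jE /= -jE => /(step_invariant I)[a [b [nab eab I' low]]].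
exists (rerooted s a (Some b)) => //.
by apply: optimal_step => //; rewrite -jE.
Qed.

Lemma run_optimal k S : partial_run P k S -> (0 < k)%N -> forall m, (k <= m <= #|T|)%N ->
  min_spanning_forest P m (forest (S m)).
Proof.
move=> Sk k0 m mk; have [s I sO] := run_invariant Sk k0 mk.
by apply/min_spanning_forestP; exists s => //; exact: inv_forest I.
Qed.

Lemma run_descendant k S : partial_run P k S -> (0 < k)%N -> forall m, (k < m <= #|T|)%N ->
  descendant P m (forest (S m.-1)) (forest (S m)).
Proof.
move=> Sk k0 [//|m] /andP[km mN] /=.
have [|s I [sP _]] := run_invariant Sk k0 (m := m.+1); first by rewrite mN ltnW.
have [|a [b [nab eab I' _]]] := step_invariant (st' := S m) I.
  by apply: (Sk.2 m.+1); rewrite km.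
by rewrite (inv_forest I) (inv_forest I'); exact: descendant_reroot.
Qed.

Lemma partial_run_step k S : partial_run P k S -> (1 < k <= #|T|)%N ->
  exists st, step P (S k) st.
Proof.
move=> Sk /andP[k1 kN]; have [|s I [[_ _ ks] _]] := run_invariant Sk (ltnW k1) (m := k).
  by rewrite leqnn.
by apply: step_exists I _; rewrite ks.
Qed.

Lemma partial_run_extend k S st : partial_run P k.+1 S -> (k < #|T|)%N ->
  step P (S k.+1) st -> partial_run P k (fun m => if m == k then st else S m).
Proof.
move=> [S0 SS] kN sk; split; first by rewrite gtn_eqF.
move=> m /andP[km mN]; rewrite gtn_eqF //; case: (eqVneq m.-1 k) => [mk|mk].
  by rewrite -(ltn_predK km) mk.
apply: SS; rewrite mN andbT ltn_neqAle km andbT; apply: contraNneq mk => <-.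
by [].
Qed.

(** No partial run gets stuck, so a run built down to stage [k] can be completed without changing
    what it already contains. *)
Lemma run_extend k S : partial_run P k S -> (0 < k <= #|T|)%N ->
  exists2 S', run P S' & forall m, (k <= m)%N -> S' m = S m.
Proof.
case: k => // k; elim: k S => [|k IH] S Sk kN; first by exists S.
have [st stk] := partial_run_step Sk kN.
have [|S' S'r S'E] := IH _ (partial_run_extend Sk kN stk); first exact: ltnW.
exists S' => // m km; rewrite S'E; first by rewrite gtn_eqF.
exact: ltnW.
Qed.

(** A minimum forest is read off any run, since runs exist and are optimal at every stage. *)
Lemma optimal_exists k : (0 < k <= #|T|)%N -> exists s, optimal P k s.
Proof.
move=> /andP[k0 kN].
have S0 : partial_run P #|T| (fun _ => initial_state P).
  by split=> // m /andP[/leq_trans lt /lt]; rewrite ltnn.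
have [|S Sr _] := run_extend S0; first by rewrite leqnn (vertex_nonempty P).
have [|s _ sO] := run_invariant Sr (ltnSn 0) (m := k); rewrite ?k0 //.
by exists s.
Qed.

(* [w] is the forest the run is heading for. *)
Definition prefers st s w := forall a b, linked w a b ->
  root_of s a <> root_of s b -> pmat st (root_of s a) (root_of s b) = pot a b ->
  orig st (root_of s a) (root_of s b) = Some (a, b).

Definition is_link w (o : option (T * T)) :=
  if o is Some (a, b) then linked w a b else false.

(** The danger is a tie between the entries of [x] and [y]. There [keep] takes the edge of [x]
    exactly when it is a link of [w], and [link_unique] shows that no wanted edge of [y] is lost in
    this way. *)
Lemma prefers_step st s w a b (y := root_of s a) (x := root_of s b)
    (keep := fun l => (pmat st l x < pmat st l y)%E ||
       (pmat st l x == pmat st l y) && is_link w (orig st l x))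
    (t := rerooted s a (Some b)) (st' := updated_state P st y x keep (forest_digraph setT t)) :
  invariant P st s -> invariant P st' t -> y <> x -> acyclic w ->
  (forall i j, linked t i j -> linked w i j) -> (forall i j, linked w i j -> edge P i j) ->
  keep_min st y x keep (roots t) ->
  prefers st s w -> prefers st' t w.
Proof.
move=> I I' yx acw tw we km pref; have ac := inv_acyclic I; have act := inv_acyclic I'.
have rtE i : root_of t i = if root_of s i == y then x else root_of s i.
  by rewrite /t root_of_reroot_some.
have rtK : roots t = roots s :\ y by rewrite /t roots_reroot_some.
have key c d : linked w c d -> root_of t c <> x -> root_of t d = x ->
    merged_pmat st y x keep (root_of t c) = pot c d ->
    merged_orig st y x keep (root_of t c) = Some (c, d).
  move=> wcd cx dx mE.
  have [cK cx'] : root_of t c \in roots t /\ root_of t c != x.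
    by split; [exact: roots_root_of|exact/eqP].
  have mmin := merged_pmat_min km cK cx'.
  have [cy rcE] : root_of s c <> y /\ root_of t c = root_of s c.
    by move: cx; rewrite rtE; case: eqP.
  rewrite {}rcE in cK cx cx' mE mmin *.
  have lowd : root_of s c <> root_of s d -> (pmat st (root_of s c) (root_of s d) <= pot c d)%E.
    by apply: (inv_lower I); exact: we.
  rewrite /merged_orig; move: (dx); rewrite rtE; case: (eqVneq (root_of s d) y) => [dy _|dy dxs].
    have cd : root_of s c <> root_of s d by rewrite dy.
    have pE : pmat st (root_of s c) y = pot c d.
      apply/le_anti; rewrite -{1}dy lowd //= -mE mmin ge_min lexx orbT.
      by [].
    case: ifP => [|_]; last by rewrite -dy; apply: pref => //; rewrite dy.
    have le_xy : (pot c d <= pmat st (root_of s c) x)%E by rewrite -mE mmin ge_min lexx.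
    rewrite /keep pE ltNge le_xy /= => /andP[/eqP pxE].
    case oE: (orig _ _ _) => [[c' d']|] //= wcd'.
    have cK' : root_of s c \in roots s by exact: roots_root_of.
    have xK : x \in roots s by exact: roots_root_of.
    case: (inv_realized I cK' xK cx') => [|[c2 [d2 [oE2 rc2 rd2 _ _]]]]; first by rewrite pxE.
    move: oE2; rewrite oE => -[cE dE]; rewrite -{}cE -{}dE in rc2 rd2.
    (* Both candidates would be links of [w] from the tree of [c] into the merged tree of [t], hence
       equal, although one ends in the old tree of [y] and the other in that of [x]. *)
    have [|||] := @link_unique _ w t c d c' d' acw act tw wcd wcd'.
    - by rewrite !rtE rc2.
    - by rewrite dx rtE rd2; case: eqP.
    - by rewrite dx rtE; case: eqP.
    by move=> _ dE; move: rd2; rewrite -dE dy.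
  have cd : root_of s c <> root_of s d by rewrite dxs.
  have pE : pmat st (root_of s c) x = pot c d.
    by apply/le_anti; rewrite -{1}dxs lowd //= -mE mmin ge_min lexx.
  have oE : orig st (root_of s c) x = Some (c, d) by rewrite -dxs; apply: pref; rewrite // dxs.
  have le_yx : (pot c d <= pmat st (root_of s c) y)%E by rewrite -mE mmin ge_min lexx orbT.
  suff -> : keep (root_of s c) by [].
  by rewrite /keep oE /= wcd andbT pE orbC -le_eqVlt.
move=> c d wcd cd; rewrite /st' /= /entry_update.
case: (eqVneq (root_of t d) x) => [dx|dx] /=.
  have cx : root_of t c <> x by rewrite -dx.
  by rewrite (introF eqP cx) /=; exact: key.
case: (eqVneq (root_of t c) x) => [cx|cx] /=.
  rewrite (potential_sym (we _ _ wcd)) => /key -> //; first by rewrite linkedC.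
  exact/eqP.
move: cx dx cd; rewrite !rtE.
case: (eqVneq (root_of s c) y) => [|_]; rewrite ?eqxx //.
case: (eqVneq (root_of s d) y) => [|_]; rewrite ?eqxx // => _ _.
exact: pref.
Qed.

(** [forest_split] writes [s] as a merge of some [t] with one tree more; a run reaching [t] comes by
    induction, and one step is appended. [w] stays fixed while [s] varies, so that preferences
    enforced at early stages serve the later merges. *)
Lemma optimal_reached n k s w : (k + n)%N = #|T| -> (0 < k)%N -> optimal P k s ->
  acyclic w -> (forall a b, linked s a b -> linked w a b) ->
  (forall a b, linked w a b -> edge P a b) ->
  exists S, [/\ partial_run P k S, invariant P (S k) s & prefers (S k) s w].
Proof.
elim: n k s => [|n IH] k s kN k0 sO acw sw we.
  rewrite addn0 in kN; exists (fun _ => initial_state P).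
  have -> : s = fun _ => None.
    apply/boolp.funext => i; apply/eqP; have : i \in roots s; last by rewrite inE.
    have [[_ _ ks] _] := sO.
    have /eqP -> : roots s == setT by rewrite eqEcard subsetT cardsT ks kN leqnn.
    by rewrite inE.
  split.
  - by split=> // m /andP[]; rewrite kN => /leq_trans lt /lt; rewrite ltnn.
  - exact: initial_invariant.
  - by move=> a b wab _; rewrite !root_of_none //= we.
have kN' : (0 < k.+1 <= #|T|)%N by rewrite /= -kN addnS ltnS leq_addr.
(* Splitting against an optimal [u] makes [t], which is no heavier, optimal as well. *)
have [u [uP umin]] := optimal_exists kN'.
have [sP smin] := sO.
have [c [d [t [ecd tP ncd /boolp.funext sE tu]]]] :=
  forest_split (@edge_weightC _ _ P) (@edge_sym _ _ P) uP sP smin.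
have act : acyclic t by case: tP.
have lkt i j : linked t i j -> linked s i j.
  by rewrite sE linked_reroot_some // => ->.
have tO : optimal P k.+1 t by split=> // v vP; apply: le_trans tu _; exact: umin.
have [|||S [Sk I pref]] := IH k.+1 t _ _ tO acw _ we.
- by rewrite addSnnS.
- by [].
- by move=> i j /lkt /sw.
set y := root_of t c; set x := root_of t d.
have yx : y <> x by [].
have yK : y \in roots t by exact: roots_root_of.
have xK : x \in roots t by exact: roots_root_of.
have wt : pweight P s = pweight P t - potential P y y + potential P c d.
  rewrite sE /pweight weight_reroot //=; [|exact: edge_weightC|by move=> e [<-]; exact/nesym].
  by rewrite edge_weightE.
(* A cheaper merge of [t] would be a forest with [k] trees lighter than [s]. *)
have low a b : edge P a b -> root_of t a <> root_of t b ->
    potential P c d - potential P y y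
      <= potential P a b - potential P (root_of t a) (root_of t a).
  move=> eab nab; have := smin _ (forest_in_reroot_some (@edge_sym _ _ P) tP nab eab).
  rewrite -/(pweight P s) -/(pweight P _) wt /pweight weight_reroot //=;
    [|exact: edge_weightC|by move=> e [<-]; exact/nesym].
  by rewrite edge_weightE // /loop_weight; lra.
have pE : pmat (S k.+1) y x = pot c d.
  have ple := inv_lower I ecd yx; apply/le_anti; rewrite ple /=.
  have /eqP yx' := yx.
  case: (inv_realized I yK xK yx') => [->|[a [b [_ ra rb eab ->]]]]; first exact: leey.
  by have := low _ _ eab; rewrite ra rb lee_fin => /(_ yx); lra.
have mp : min_pair (S k.+1) y x.
  rewrite /min_pair (inv_root_set I); split=> //; first exact/eqP.
  have /eqP yx' := yx.
  move=> l i lK iK li; rewrite !(inv_vmat I) // pE.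
  case: (inv_realized I lK iK li) => [->|[a [b [_ ra rb eab ->]]]]; first by rewrite leey.
  rewrite -!EFinB lee_fin -ra; apply: low => //; rewrite ra rb; exact/eqP.
have wcd : linked w c d by apply: sw; rewrite sE linked_reroot_some // !eqxx orbT.
have oE : orig (S k.+1) y x = Some (c, d) by exact: pref.
pose keep l := (pmat (S k.+1) l x < pmat (S k.+1) l y)%E ||
       (pmat (S k.+1) l x == pmat (S k.+1) l y) && is_link w (orig (S k.+1) l x).
have km K : keep_min (S k.+1) y x keep K.
  by move=> l _ _; rewrite /keep; case: ltgtP => //= _; case: ifP.
have stS := updated_state_step I mp oE (km _).
have [a [b [nab eab I' _]]] := step_invariant I stS.
(* The arc returned by [step_invariant] is not known to be [(c, d)], but the merge along it has the
   same digraph. *)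
have tE : rerooted t a (Some b) = s.
  rewrite sE; apply/boolp.funext/(@forest_digraph_inj _ setT).
  by rewrite -(inv_forest I').
rewrite {}tE in I'; exists (fun m => if m == k then
  updated_state P (S k.+1) y x keep (forest_digraph setT (rerooted t c (Some d))) else S m).
rewrite eqxx; split=> //.
  by apply: partial_run_extend => //; rewrite -kN addnS ltnS leq_addr.
have := @prefers_step (S k.+1) t w c d I; rewrite -sE; apply=> //.
by rewrite sE; rewrite sE in I'.
Qed.

Lemma min_spanning_forest_reached k F : (0 < k <= #|T|)%N -> min_spanning_forest P k F ->
  exists2 S, run P S & forest (S k) = F.
Proof.
move=> /andP[k0 kN] /min_spanning_forestP[s sO ->].
have [[ac es _] _] := sO.
(* The target [w] is [s] itself. *)
have [S [Sk I _]] := optimal_reached (subnKC kN) k0 sO ac (fun _ _ => id) es.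
have [|S' S'r S'E] := run_extend Sk; first by rewrite k0.
by exists S'; rewrite // S'E // (inv_forest I).
Qed.

End Optimality.

(** * The program *)

Section CostedComputations.

(** For the deterministic pieces only; the search for a pair and the table update can break ties,
    and get separate soundness and completeness lemmas. *)
Definition computes (A : Type) (m : costed A) (a : A) :=
  (exists t, m a t) /\ forall b t, m b t -> b = a.

Definition bounded (A : Type) (m : costed A) (n : nat) := forall a t, m a t -> t <= n.

Lemma computes_ret A (a : A) : computes (ret a) a.
Proof. by split=> [|b t []]; first by exists 0. Qed.

Lemma computes_op A (a : A) : computes (op a) a.
Proof. by split=> [|b t []]; first by exists 1. Qed.

Lemma computes_bind A B (m : costed A) (f : A -> costed B) a b :
  computes m a -> computes (f a) b -> computes (bind m f) b.
Proof.
move=> [[t1 ma] mu] [[t2 fb] fu]; split=> [|b' t [a' [t1' [t2' [ma' fb' _]]]]].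
  by exists (t1 + t2), a, t1, t2.
by move: fb'; rewrite (mu _ _ ma') => /fu.
Qed.

Lemma computes_traverse A B (f : B -> A -> costed B) (g : B -> A -> B) s b :
  (forall b x, computes (f b x) (g b x)) -> computes (traverse f s b) (foldl g b s).
Proof.
move=> fg; elim: s b => [|x s IH] b /=; first exact: computes_ret.
apply: computes_bind (computes_op x) _; exact: computes_bind (fg b x) (IH _).
Qed.

Lemma foldl_invariant A B (g : B -> A -> B) (Q : seq A -> B -> Prop) s b :
  Q [::] b -> (forall pre x b, Q pre b -> Q (rcons pre x) (g b x)) -> Q s (foldl g b s).
Proof.
move=> Q0 QS; elim/last_ind: s => [|s x IH] //.
by rewrite -cats1 foldl_cat cats1 /=; exact: QS.
Qed.

(** [Q] speaks of the processed prefix. The equation [s = pre ++ x :: post] lets the body know that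
    [x] is in [s] and, when [s] is duplicate-free, not in [pre]. *)
Lemma traverse_sound A B (f : B -> A -> costed B) (Q : seq A -> B -> Prop) s b b' t :
  Q [::] b ->
  (forall pre x post b b' t, s = pre ++ x :: post ->
     Q pre b -> f b x b' t -> Q (rcons pre x) b') ->
  traverse f s b b' t -> Q s b'.
Proof.
move=> Q0 QS; suff H post : forall pre b t, s = pre ++ post -> Q pre b ->
    traverse f post b b' t -> Q s b' by exact: (H s [::]).
elim: post => [|x post IH] pre {Q0}b0 {}t sE Qb /=.
  by rewrite sE cats0 => -[-> _].
move=> [_ [_ [_ [[-> _] [b1 [t1 [t2 [fb tb _]]]] _]]]].
apply: (IH (rcons pre x)) tb; first by rewrite cat_rcons.
exact: QS sE Qb fb.
Qed.

Lemma traverse_complete A B (f : B -> A -> costed B) (Q : seq A -> B -> Prop) s b :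
  Q [::] b ->
  (forall pre x post b, s = pre ++ x :: post -> Q pre b ->
     exists b' t, f b x b' t /\ Q (rcons pre x) b') ->
  exists b' t, traverse f s b b' t /\ Q s b'.
Proof.
move=> Q0 QS; suff H post : forall pre b, s = pre ++ post -> Q pre b ->
    exists b' t, traverse f post b b' t /\ Q s b' by exact: (H s [::]).
elim: post => [|x post IH] pre {Q0}b0 sE Qb /=.
  by exists b0, 0; rewrite sE cats0.
have [b1 [t1 [fb Qb1]]] := QS _ _ _ _ sE Qb.
have [|b2 [t2 [tb Qb2]]] := IH (rcons pre x) _ _ Qb1; first by rewrite cat_rcons.
exists b2, (1 + (t1 + t2)); split=> //.
by exists x, 1, (t1 + t2); split=> //; exists b1, t1, t2.
Qed.

Lemma reaches_sub A (m : costed A) (P Q : A -> Prop) : (forall a, P a -> Q a) ->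
  (exists a t, m a t /\ P a) -> exists a t, m a t /\ Q a.
Proof. by move=> PQ [a [t [mt /PQ]]]; exists a, t. Qed.

Lemma bounded_leq A (m : costed A) n n' : n <= n' -> bounded m n -> bounded m n'.
Proof. by move=> nn' mn a t /mn /leq_trans; apply. Qed.

Lemma bounded_ret A (a : A) : bounded (ret a) 0.
Proof. by move=> b t [_ ->]. Qed.

Lemma bounded_op A (a : A) : bounded (op a) 1.
Proof. by move=> b t [_ ->]. Qed.

Lemma bounded_compare (R : realType) (u w : \bar R) : bounded (compare u w) 1.
Proof. by move=> b t [_ ->]. Qed.

Lemma bounded_bind A B (m : costed A) (f : A -> costed B) n1 n2 :
  bounded m n1 -> (forall a t, m a t -> bounded (f a) n2) -> bounded (bind m f) (n1 + n2).
Proof.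
move=> mn fn b t [a [t1 [t2 [ma fb ->]]]].
by apply: leq_add; [exact: mn ma|exact: fn ma _ _ fb].
Qed.

Lemma bounded_bind_op A B (a : A) (f : A -> costed B) n :
  bounded (f a) n -> bounded (bind (op a) f) n.+1.
Proof.
move=> fn; rewrite -add1n; apply: bounded_bind (@bounded_op _ _) _.
by move=> b t [-> _].
Qed.

Lemma bounded_traverse A B (f : B -> A -> costed B) n s b :
  (forall b x, bounded (f b x) n) -> bounded (traverse f s b) (size s * n.+1).
Proof.
move=> fn; elim: s b => [|x s IH] b /=; first exact: bounded_ret.
rewrite mulSn -[n.+1]add1n -addnA; apply: bounded_bind (@bounded_op _ _) _ => x' _ _.
by apply: bounded_bind (fn _ _) _ => b' _ _; exact: IH.
Qed.

End CostedComputations.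

(** * Search for the minimum, rerooting, deletion and output *)

Section ProgramPieces.
Variables (R : realType) (T : finType).
Implicit Types (K : seq T) (v : T -> T -> \bar R) (D : rel T) (best : option (T * T)).

(** [D] holds the pairs examined so far; [None] is correct as long as all of them are diagonal. *)
Definition minimal_on K v D best :=
  if best is Some (y, x) then
    [/\ y \in K, x \in K, y != x &
        forall l i, D l i -> l != i -> (v y x <= v l i)%E]
  else forall l i, D l i -> l = i.

Lemma minimal_on_sub K v D D' best : (forall l i, D' l i -> D l i) ->
  minimal_on K v D best -> minimal_on K v D' best.
Proof.
move=> DD; case: best => [[y x] [yK xK yx m]|m l i /DD]; last exact: m.
by split=> // l i /DD; exact: m.
Qed.

Lemma find_min_sound K v best t : find_min K v best t ->
  minimal_on K v (fun l i => (l \in K) && (i \in K)) best.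
Proof.
apply: (traverse_sound (Q := fun pre => minimal_on K v (fun l i => (l \in pre) && (i \in K)))).
  by [].
move=> pre l post b b' {}t KE Qb inner.
have lK : l \in K by rewrite KE mem_cat mem_head orbT.
(* The rows in [pre] are finished, and row [l] has been scanned along [pre']. *)
pose D (pre' : seq T) l' i' := (l' \in pre) && (i' \in K) || (l' == l) && (i' \in pre').
suff : minimal_on K v (D K) b'.
  apply: minimal_on_sub => l' i'; rewrite mem_rcons inE /D => /andP[/orP[/eqP->|->] ->] //.
  by rewrite eqxx orbT.
move: inner; apply: (traverse_sound (Q := fun pre' => minimal_on K v (D pre'))).
  by apply: minimal_on_sub Qb => l' i'; rewrite /D in_nil andbF orbF.
move=> pre' i post' c c' {}t KE' Qc [same [t1 [t2 [[-> _] body _]]]].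
have iK : i \in K by rewrite KE' mem_cat mem_head orbT.
have DE l' i' : D (rcons pre' i) l' i' = D pre' l' i' || (l' == l) && (i' == i).
  by rewrite /D mem_rcons inE andb_orr orbA orbAC.
move: body; case: eqVneq => [li [-> _]|li].
  case: c Qc => [[y x] [yK xK yx m]|m].
    split=> // l' i'; rewrite DE => /orP[/m //|/andP[/eqP-> /eqP->]].
    by rewrite li eqxx.
  by move=> l' i'; rewrite DE => /orP[/m //|/andP[/eqP-> /eqP->]].
case: c Qc => [[y x] [yK xK yx m]|m]; last first.
  move=> [-> _]; split=> // l' i'; rewrite DE => /orP[/m ->|/andP[/eqP-> /eqP->]] //.
  by rewrite eqxx.
move=> [vyx [? [? [[-> _] [vli [? [? [[-> _] [keep [? [? [[le _] res _]]]] _]]]] _]]]].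
case: keep le res => le [-> _]; split=> // l' i'; rewrite DE => /orP[Dli|/andP[/eqP-> /eqP->]] //.
  exact: m.
by move=> li'; apply: le_trans le _; exact: m.
Qed.

(** With ties resolved suitably, [(y, x)] becomes the best pair when it is met and remains so. *)
Lemma find_min_complete K v y x : y \in K -> x \in K -> y != x ->
  (forall l i, l \in K -> i \in K -> l != i -> (v y x <= v l i)%E) ->
  exists t, find_min K v (Some (y, x)) t.
Proof.
move=> yK xK yx vmin.
pose Q D (b : option (T * T)) := (D y x -> b = Some (y, x)) /\
  (forall l i, b = Some (l, i) -> [/\ l \in K, i \in K & l != i]).
suff [b [t [fb [Qb _]]]] : exists b t, find_min K v b t /\
    Q (fun l i => (l \in K) && (i \in K)) b.
  by exists t; rewrite -Qb ?yK.
rewrite /find_min; apply: (traverse_complete (Q := fun pre => Q (fun l i => (l \in pre) && (i \in K)))).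
  by [].
move=> pre l post b KE [Qb bK].
have lK : l \in K by rewrite KE mem_cat mem_head orbT.
pose D (pre' : seq T) l' i' := (l' \in pre) && (i' \in K) || (l' == l) && (i' \in pre').
apply: (reaches_sub (P := Q (D K))) => [b' [Qb' b'K]|].
  split=> //; rewrite mem_rcons inE => /andP[/orP[/eqP yl|ypre] _]; apply: Qb'.
    by rewrite /D yl eqxx xK orbT.
  by rewrite /D ypre xK.
apply: (traverse_complete (Q := fun pre' => Q (D pre'))).
  by split=> //; rewrite /D in_nil andbF orbF => /Qb.
move=> pre' i post' c KE' [Qc cK].
have iK : i \in K by rewrite KE' mem_cat mem_head orbT.
have DE : D (rcons pre' i) y x = D pre' y x || (y == l) && (x == i).
  by rewrite /D mem_rcons inE andb_orr orbA orbAC.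
case: (eqVneq l i) => [li|li].
  exists c, (1 + 0); split.
    by exists (l == i), 1, 0; split=> //; rewrite li eqxx.
  split=> //; rewrite DE => /orP[/Qc //|/andP[/eqP yl /eqP xi]].
  by move: yx; rewrite yl xi li eqxx.
case: c Qc cK => [[y' x']|] Qc cK; last first.
  exists (Some (l, i)), (1 + 1); split.
    by exists (l == i), 1, 1; split=> //; rewrite (negbTE li).
  split=> [|l' i' [<- <-]] //.
  by rewrite DE => /orP[/Qc //|/andP[/eqP-> /eqP->]].
have [y'K x'K yx'] := cK _ _ erefl.
(* The old best pair gives way only to [(y, x)] or to a strictly smaller entry. *)
pose keep := ((y, x) != (l, i)) && (v y' x' <= v l i)%E.
have keepP : if keep then (v y' x' <= v l i)%E else (v l i <= v y' x')%E.
  rewrite /keep; case: eqVneq => [[<- <-]|_] /=; first exact: vmin.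
  by case: leP => // /ltW.
exists (if keep then Some (y', x') else Some (l, i)), (1 + (1 + (1 + (1 + ~~ keep)))); split.
  exists false, 1, (1 + (1 + (1 + ~~ keep))); split=> //.
  exists (v y' x'), 1, (1 + (1 + ~~ keep)); split=> //.
  exists (v l i), 1, (1 + ~~ keep); split=> //.
  exists keep, 1, (nat_of_bool (~~ keep)); split=> //.
  by case: (keep).
split=> [|l' i']; last by case: (keep) => -[<- <-].
rewrite DE => /orP[/Qc yxE|/andP[/eqP yl /eqP xi]]; last first.
  by rewrite /keep yl xi eqxx.
case: yxE => y'E x'E; rewrite /keep y'E x'E vmin // andbT.
by case: eqVneq => [[-> ->]|].
Qed.

(** An inner iteration costs at most 6: the traversal charge, the test, two reads, the comparison
    and the replacement. *)
Lemma bounded_find_min K v : bounded (find_min K v) (size K * (size K * 6).+1).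
Proof.
apply: bounded_traverse => b l; apply: bounded_traverse => best i.
rewrite -[5]/(1 + 4); apply: bounded_bind (@bounded_op _ _) _ => same _ _.
case: same; first exact: bounded_leq (@bounded_ret _ _).
case: best => [[y x]|]; last exact: bounded_leq (@bounded_op _ _).
rewrite -[4]/(1 + 3); apply: bounded_bind (@bounded_op _ _) _ => vyx _ _.
rewrite -[3]/(1 + 2); apply: bounded_bind (@bounded_op _ _) _ => vli _ _.
rewrite -[2]/(1 + 1); apply: bounded_bind (@bounded_compare _ _ _) _ => keep _ _.
case: keep; first exact: bounded_leq (@bounded_ret _ _).
exact: bounded_op.
Qed.

Lemma computes_reroot n s (c : T) new : computes (reroot n s c new) (reverse_path n s c new).
Proof.
elim: n s c new => [|n IH] s c new /=; first exact: computes_ret.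
apply: computes_bind (computes_op _) _; apply: computes_bind (computes_op _) _.
case: (s c) => [d|]; [exact: IH|exact: computes_ret].
Qed.

Lemma bounded_reroot n s (c : T) new : bounded (reroot n s c new) (n * 2).
Proof.
elim: n s c new => [|n IH] s c new /=; first exact: bounded_ret.
rewrite mulSn -[2]/(1 + 1) -addnA; apply: bounded_bind (@bounded_op _ _) _ => [[d|]] _ _;
  apply: bounded_bind (@bounded_op _ _) _ => s' _ _; first exact: IH.
exact: bounded_leq (@bounded_ret _ _).
Qed.

Lemma computes_delete (y : T) K : computes (delete y K) (rev [seq l <- K | l != y]).
Proof.
have -> : rev [seq l <- K | l != y] =
    foldl (fun acc l => if l == y then acc else l :: acc) [::] K.
  elim/last_ind: K => // K l IH; rewrite -cats1 filter_cat rev_cat foldl_cat -IH /=.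
  by case: (l == y).
apply: computes_traverse => acc l; apply: computes_bind (computes_op _) _.
by case: (l == y); [exact: computes_ret|exact: computes_op].
Qed.

Lemma bounded_delete (y : T) K : bounded (delete y K) (size K * 3).
Proof.
apply: bounded_traverse => acc l; rewrite -[2]/(1 + 1).
apply: bounded_bind (@bounded_op _ _) _ => same _ _.
by case: same; [exact: bounded_leq (@bounded_ret _ _)|exact: bounded_op].
Qed.

Lemma computes_output (s : store R T) : exists2 out, computes (output s) out &
  forest_digraph setT (succ s) = Digraph setT [set a in out].
Proof.
pose g (acc : seq (T * T)) i := if succ s i is Some j then (i, j) :: acc else acc.
exists (foldl g [::] (enum T)).
  apply: computes_traverse => acc i; apply: computes_bind (computes_op _) _.
  by rewrite /g; case: (succ s i) => [j|]; [exact: computes_op|exact: computes_ret].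
congr Digraph; apply/setP => a; rewrite !inE.
suff -> : (a \in foldl g [::] (enum T)) = (a.1 \in enum T) && (succ s a.1 == Some a.2).
  by rewrite mem_enum.
apply: (foldl_invariant (Q := fun pre acc =>
  (a \in acc) = (a.1 \in pre) && (succ s a.1 == Some a.2))) => // pre i acc IH.
rewrite /g mem_rcons inE; case: a IH => a1 a2 /= IH.
case E: (succ s i) => [j|]; rewrite ?inE IH; case: (eqVneq a1 i) => [->|ai] //=.
  by rewrite E xpair_eqE eqxx (inj_eq Some_inj) eq_sym /=; case: (j == a2); rewrite ?andbT ?andbF.
  by rewrite xpair_eqE (negbTE ai).
by rewrite E andbF.
Qed.

Lemma bounded_output (s : store R T) : bounded (output s) (#|T| * 3).
Proof.
rewrite cardE; apply: bounded_traverse => acc i; rewrite -[2]/(1 + 1).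
apply: bounded_bind (@bounded_op _ _) _ => -[j|] _ _; first exact: bounded_op.
exact: bounded_leq (@bounded_ret _ _).
Qed.

End ProgramPieces.

(** * The update of the tables after a merge *)

Section UpdateTables.
Variables (R : realType) (T : finType) (y x : T).
Hypothesis yx : y != x.
Implicit Types (s : tables R T) (K : seq T) (l i : T) (keep : T -> bool).

Definition overwrite A (M : T -> T -> A) i j (a : A) : T -> T -> A :=
  fun i' j' => if (i' == i) && (j' == j) then a else M i' j'.

Definition index_update (keep : bool) s l : tables R T :=
  let m := if keep then tp s l x else tp s l y in
  let e := torig s l (if keep then x else y) in
  let p := overwrite (overwrite (tp s) l x m) x l m in
  Tables p
    (overwrite (overwrite (tv s) l x (m - p l l)%E) x l (m - p x x)%E)
    (overwrite (overwrite (torig s) l x e) x l (omap (@swap T) e)).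

Definition keep_ok s l (keep : bool) :=
  if keep then (tp s l x <= tp s l y)%E else (tp s l y <= tp s l x)%E.

Lemma update_index_sound s l s' t : update_index y x s l s' t ->
  if l == x then s' = s else exists2 keep : bool, keep_ok s l keep & s' = index_update keep s l.
Proof.
move=> [same [? [? [[-> _] body _]]]]; move: body; case: (l == x); first by case.
move=> [? [? [? [[-> _] [? [? [? [[-> _] [keep [? [? [[le _] body _]]]] _]]]] _]]]].
exists keep => //; move: body.
move=> [? [? [? [[-> _] [? [? [? [[-> _] [? [? [? [[-> _] body _]]]] _]]]] _]]]]; move: body.
move=> [? [? [? [[-> _] [? [? [? [[-> _] [? [? [? [[-> _] body _]]]] _]]]] _]]]]; move: body.
move=> [? [? [? [[-> _] [? [? [? [[-> _] [? [? [? [[-> _] body _]]]] _]]]] _]]]]; move: body.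
by move=> [? [? [? [[-> _] [? [? [? [[-> _] [? [? [? [[-> _] [-> _] _]]]] _]]]] _]]]].
Qed.

Lemma update_index_complete s l (keep : bool) : keep_ok s l keep ->
  exists t, update_index y x s l (if l == x then s else index_update keep s l) t.
Proof.
have H A (m : costed A) (f : A -> costed (tables R T)) a b :
    (exists t, m a t) -> (exists t, f a b t) -> exists t, bind m f b t.
  by move=> [t1 mt] [t2 ft]; exists (t1 + t2), a, t1, t2.
move=> ko; rewrite /update_index; apply: (H _ _ _ (l == x)); first by exists 1.
case: (l == x); first by exists 0.
apply: (H); first by exists 1.
apply: (H); first by exists 1.
apply: (H _ _ _ keep); first by exists 1.
do 12! [apply: (H); first by exists 1].
by exists 0.
Qed.

(** A test, two reads and a comparison come before twelve further operations. *)
Lemma bounded_update_index s l : bounded (update_index y x s l) 16.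
Proof.
apply: bounded_bind_op; case: (l == x); first exact: bounded_leq (@bounded_ret _ _).
do 2! apply: bounded_bind_op.
rewrite -[13]/(1 + 12); apply: bounded_bind (@bounded_compare _ _ _) _ => keep _ _.
do 12! apply: bounded_bind_op.
exact: bounded_ret.
Qed.

(** The loop invariant: [entry_update] carried out for the indices of [pre] only. *)
Definition entry_update_on (pre : seq T) A (M : T -> T -> A) (col row : T -> A) :
    T -> T -> A :=
  fun l i => if [&& i == x, l != x & l \in pre] then col l
             else if [&& l == x, i != x & i \in pre] then row i else M l i.

Lemma entry_update_on_rcons pre A (M : T -> T -> A) col row l : l != x ->
  overwrite (overwrite (entry_update_on pre M col row) l x (col l)) x l (row l) =2
  entry_update_on (rcons pre l) M col row.
Proof.
move=> lx l' i'; rewrite /overwrite /entry_update_on !mem_rcons !inE.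
case: (eqVneq l' x) => [->|l'x] /=.
  rewrite andbF [x == l]eq_sym (negbTE lx) /=; case: (eqVneq i' l) => [->|i'l] //=.
  by rewrite lx.
case: (eqVneq i' x) => [->|i'x] /=; last by rewrite !andbF.
by rewrite andbT; case: (eqVneq l' l) => [->|].
Qed.

Lemma entry_update_on_x pre A (M : T -> T -> A) col row :
  entry_update_on (rcons pre x) M col row =2 entry_update_on pre M col row.
Proof.
move=> l i; rewrite /entry_update_on !mem_rcons !inE.
by case: (eqVneq l x) => [->|lx]; case: (eqVneq i x) => [->|ix].
Qed.

Definition updated_tables (pre : seq T) keep s0 s :=
  let m l := tp s0 l (if keep l then x else y) in
  let e l := torig s0 l (if keep l then x else y) in
  [/\ tp s =2 entry_update_on pre (tp s0) m m,
      tv s =2 entry_update_on pre (tv s0) (fun l => m l - tp s0 l l)%E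
                                          (fun i => m i - tp s0 x x)%E
    & torig s =2 entry_update_on pre (torig s0) e (fun i => omap (@swap T) (e i))].

Lemma updated_tables_nil keep s0 : updated_tables [::] keep s0 s0.
Proof. by split=> l i; rewrite /entry_update_on in_nil !andbF. Qed.

(** Processing an index writes only its two entries with [x], so the comparison for a later index
    still sees the original values. *)
Lemma updated_tables_old pre keep s0 s l : updated_tables pre keep s0 s ->
  l \notin pre -> l != x -> tp s l x = tp s0 l x /\ tp s l y = tp s0 l y.
Proof.
case=> pE _ _ lp lx; rewrite !pE /entry_update_on (negbTE lp) (negbTE lx) !andbF.
by rewrite (negbTE yx).
Qed.

Lemma updated_tables_rcons pre keep s0 s l : updated_tables pre keep s0 s ->
  l \notin pre -> updated_tables (rcons pre l) keep s0
    (if l == x then s else index_update (keep l) s l).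
Proof.
move=> U lp; have [pE vE oE] := U; case: (eqVneq l x) => [->|lx].
  by split=> l' i'; rewrite entry_update_on_x.
have [px py] := updated_tables_old U lp lx.
have mE : (if keep l then tp s l x else tp s l y) = tp s0 l (if keep l then x else y).
  by rewrite px py; case: (keep l).
have eE : torig s l (if keep l then x else y) = torig s0 l (if keep l then x else y).
  rewrite oE /entry_update_on (negbTE lp) (negbTE lx) !andbF.
  by [].
(* Loop weights are read after the writes; these are off the diagonal because [l] differs from
   [x]. *)
have plE : overwrite (overwrite (tp s) l x (tp s0 l (if keep l then x else y))) x l
    (tp s0 l (if keep l then x else y)) l l = tp s0 l l.
  by rewrite /overwrite (negbTE lx) andbF /= pE /entry_update_on (negbTE lx).
have pxE : overwrite (overwrite (tp s) l x (tp s0 l (if keep l then x else y))) x l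
    (tp s0 l (if keep l then x else y)) x x = tp s0 x x.
  by rewrite /overwrite [x == l]eq_sym (negbTE lx) andbF /= pE /entry_update_on eqxx.
rewrite /index_update mE eE plE pxE; split=> l' i' /=; rewrite -entry_update_on_rcons //.
- by rewrite /overwrite pE.
- by rewrite /overwrite vE.
- by rewrite /overwrite oE.
Qed.

(** Allows [keep] to be defined one index at a time, as the comparisons are made. *)
Lemma eq_updated_tables pre keep keep' s0 s : {in pre, keep =1 keep'} ->
  updated_tables pre keep s0 s -> updated_tables pre keep' s0 s.
Proof.
move=> kk [pE vE oE]; split=> l i; rewrite ?pE ?vE ?oE /entry_update_on;
  by case: ifP => [/and3P[_ _ /kk ->] //|_]; case: ifP => // /and3P[_ _ /kk ->].
Qed.

Lemma update_tables_sound K s0 s t : uniq K -> traverse (update_index y x) K s0 s t ->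
  exists2 keep, forall l, l \in K -> l != x -> keep_ok s0 l (keep l)
    & updated_tables K keep s0 s.
Proof.
move=> uK; apply: (traverse_sound (Q := fun pre s => exists2 keep : T -> bool,
  forall l, l \in pre -> l != x -> keep_ok s0 l (keep l) & updated_tables pre keep s0 s)).
  by exists xpredT => //; exact: updated_tables_nil.
move=> pre l post s1 s2 {}t KE [keep kok U] /update_index_sound us.
have lp : l \notin pre.
  by move: uK; rewrite KE -cat_rcons cat_uniq rcons_uniq => /and3P[/andP[]].
case: (eqVneq l x) us => [lx s2E|lx [k ko s2E]].
  exists keep; last by have := updated_tables_rcons U lp; rewrite lx eqxx s2E.
  by move=> l'; rewrite mem_rcons inE => /orP[/eqP->|/kok //]; rewrite lx eqxx.
pose keep' l' := if l' == l then k else keep l'.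
have kk : {in pre, keep =1 keep'}.
  by move=> l' l'p; rewrite /keep'; case: eqVneq => // l'l; rewrite -l'l l'p in lp.
exists keep'; last first.
  have := updated_tables_rcons (eq_updated_tables kk U) lp.
  by rewrite (negbTE lx) s2E /keep' eqxx.
move=> l'; rewrite mem_rcons inE => /orP[/eqP-> _|l'p l'x]; last by rewrite -kk //; exact: kok.
rewrite /keep' eqxx; have [px py] := updated_tables_old U lp lx.
by move: ko; rewrite /keep_ok px py.
Qed.

Lemma update_tables_complete K s0 keep : uniq K ->
  (forall l, l \in K -> l != x -> keep_ok s0 l (keep l)) ->
  exists s t, traverse (update_index y x) K s0 s t /\ updated_tables K keep s0 s.
Proof.
move=> uK kok; apply: (traverse_complete (Q := fun pre => updated_tables pre keep s0)).
  exact: updated_tables_nil.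
move=> pre l post s KE U.
have lp : l \notin pre.
  by move: uK; rewrite KE -cat_rcons cat_uniq rcons_uniq => /and3P[/andP[]].
have lK : l \in K by rewrite KE mem_cat mem_head orbT.
have [lx|lx] := eqVneq l x.
  exists s, (1 + 0); split; first by exists true, 1, 0; rewrite lx eqxx.
  by have := updated_tables_rcons U lp; rewrite lx eqxx.
have [px py] := updated_tables_old U lp lx.
have [|t us] := @update_index_complete s l (keep l).
  by rewrite /keep_ok px py; exact: kok.
by exists (if l == x then s else index_update (keep l) s l), t; split=> //; exact: updated_tables_rcons.
Qed.

End UpdateTables.

(** * Correspondence between executions of the program and runs *)

Section Simulation.
Variables (R : realType) (T : finType) (P : potential_graph R T).
Implicit Types (s : store R T) (st : state R T) (l i x y a b : T) (K : {set T}).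

Definition store_state s : state R T :=
  State (forest_digraph setT (succ s)) (tp (tabs s)) (tv (tabs s)) (torig (tabs s)).

(** Tables are compared at root indices only: the program leaves stale entries elsewhere, about
    which [updated] says nothing. *)
Record simulates s st : Prop := Simulates {
  sim_uniq : uniq (root_list s);
  sim_roots : root_list s =i roots (succ s);
  sim_forest : forest st = forest_digraph setT (succ s);
  sim_agree : agree (roots (succ s)) st (store_state s) }.

Lemma agree_trans K st1 st2 st3 : agree K st1 st2 -> agree K st1 st3 -> agree K st2 st3.
Proof.
by move=> A B l i lK iK; have [-> -> ->] := A l i lK iK; have [-> -> ->] := B l i lK iK.
Qed.

Section OneStep.
Variables (s : store R T) (st : state R T) (y x a b : T) (keep : T -> bool).
Variable tabs' : tables R T.
Let K' := rev [seq l <- root_list s | l != y].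
Let s' := Store K' (rerooted (succ s) a (Some b)) tabs'.
Hypotheses (sim : simulates s st) (I : invariant P st (succ s))
  (mp : min_pair st y x) (oE : orig st y x = Some (a, b)).

Lemma mem_kept l : (l \in K') = (l \in roots (succ s) :\ y).
Proof. by rewrite mem_rev mem_filter (sim_roots sim) in_setD1. Qed.

Lemma min_pair_ends : [/\ root_of (succ s) a = y, root_of (succ s) b = x &
  root_of (succ s) a <> root_of (succ s) b].
Proof.
have [a' [b' [oE' ra rb _ _]]] := min_pair_edge I mp.
move: oE'; rewrite oE => -[-> ->]; split=> //; rewrite ra rb.
by have [_ _ /eqP] := mp.
Qed.

Lemma roots_merged : roots (rerooted (succ s) a (Some b)) = roots (succ s) :\ y.
Proof.
have [ra _ nab] := min_pair_ends.
by rewrite roots_reroot_some ?ra //; [exact: inv_acyclic I|rewrite -ra].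
Qed.

Lemma min_pair_mem : [/\ y \in roots (succ s), x \in roots (succ s) :\ y & y != x].
Proof.
have [+ + yx _] := mp; rewrite (inv_root_set I) => yK xK; split=> //.
by rewrite in_setD1 xK eq_sym yx.
Qed.

Lemma keep_ok_min l : l \in K' ->
  keep_ok y x (tabs s) l (keep l) <->
  (if keep l then (pmat st l x <= pmat st l y)%E else (pmat st l y <= pmat st l x)%E).
Proof.
have [yK xK yx] := min_pair_mem; rewrite mem_kept => /setD1P[_ lK].
move: xK => /setD1P[_ xK].
have [/= px _ _] := sim_agree sim lK xK; have [/= py _ _] := sim_agree sim lK yK.
by rewrite /keep_ok px py.
Qed.

Lemma agree_updated_store F : updated_tables y x K' keep (tabs s) tabs' ->
  agree (roots (succ s) :\ y) (updated_state P st y x keep F) (store_state s').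
Proof.
move=> [pE vE oE'] l i lK' iK'; have [yK xK yx] := min_pair_mem.
have [lK iK] : l \in roots (succ s) /\ i \in roots (succ s).
  by split; [case/setD1P: lK'|case/setD1P: iK'].
have [pli vli oli] := sim_agree sim lK iK.
have xK0 : x \in roots (succ s) by case/setD1P: xK.
have agr j : j \in roots (succ s) -> let z := if keep j then x else y in
    tp (tabs s) j z = pmat st j z /\ torig (tabs s) j z = orig st j z.
  move=> jK z; have zK : z \in roots (succ s) by rewrite /z; case: (keep j).
  by have [] := sim_agree sim jK zK.
have [pl ol] := agr _ lK; have [pi oi] := agr _ iK.
have [/= lp _ _] := sim_agree sim lK lK; have [/= xp _ _] := sim_agree sim xK0 xK0.
rewrite /= pE vE oE' /entry_update_on /entry_update !mem_kept lK' iK' !andbT.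
rewrite /merged_pmat /merged_orig pl ol pi oi lp xp (inv_loop I lK) (inv_loop I xK0).
rewrite -pli -vli -oli /=.
by case: ifP => _ //; case: ifP.
Qed.

Lemma simulates_step st' : forest st' = forest_digraph setT (succ s') ->
  agree (roots (succ s) :\ y) st' (store_state s') -> simulates s' st'.
Proof.
move=> fE ag; split=> //=.
- by rewrite rev_uniq filter_uniq ?(sim_uniq sim).
- by move=> l; rewrite mem_kept roots_merged.
- by rewrite roots_merged.
Qed.

End OneStep.

(** The next state can be read off the store, stale entries included, because [updated] constrains
    only the entries at surviving roots. *)
Lemma step_program_sound s st s' t : simulates s st -> invariant P st (succ s) ->
  1 < #|roots (succ s)| -> step_program s s' t ->
  step P st (store_state s') /\ simulates s' (store_state s').
Proof.
move=> sim I K1 [best [? [? [/find_min_sound fm body _]]]].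
case: best fm body => [[y x] [yK xK yx vmin]|none _]; last first.
  have [y [x [yK xK]]] := roots_two K1.
  by rewrite (none y x) ?eqxx // !(sim_roots sim) yK.
move: yK xK; rewrite !(sim_roots sim) => yK xK.
have mp : min_pair st y x.
  rewrite /min_pair (inv_root_set I); split=> // l i lK iK li.
  have [_ <- _] := sim_agree sim yK xK; have [_ <- _] := sim_agree sim lK iK.
  by apply: vmin; rewrite // !(sim_roots sim) lK.
have [a [b [oE _ _ _ _]]] := min_pair_edge I mp.
move=> [e [? [? [[-> _] body _]]]]; move: body.
have [/= _ _ ->] := sim_agree sim yK xK; rewrite oE.
move=> [u [? [? [/(computes_reroot _ _ _ _).2 -> body _]]]]; move: body.
move=> [K' [? [? [/(computes_delete _ _).2 -> body _]]]]; move: body.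
move=> [tabs' [? [? [up [-> _] _]]]].
have [ra rb nab] := min_pair_ends I mp oE.
set s1 := Store _ _ _.
have uK : uniq (rev [seq l <- root_list s | l != y]).
  by rewrite rev_uniq filter_uniq // (sim_uniq sim).
have [keep kok U] := update_tables_sound yx uK up.
split; last exact: simulates_step sim I mp oE _ _ _.
exists y, x, a, b; split=> //.
  rewrite (inv_forest I); apply/mergedP => //; first exact: inv_acyclic I.
    by apply/eqP; rewrite inE in yK.
  by rewrite -ra; exact/nesym.
apply/updatedP; rewrite (inv_root_set I); first by case: (min_pair_mem I mp).
exists keep; last exact (agree_updated_store a b sim I mp _ U).
move=> l lK lx; apply/(keep_ok_min keep sim I mp); rewrite ?(mem_kept y sim) //.
by apply: kok; rewrite ?(mem_kept y sim).
Qed.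

(** Both choices of the step are handed to the program: the pair through [find_min_complete], and
    the [keep] extracted from [updated] through [update_tables_complete]. *)
Lemma step_program_complete s st st' : simulates s st -> invariant P st (succ s) ->
  step P st st' -> exists s' t, step_program s s' t /\ simulates s' st'.
Proof.
move=> sim I [y [x [a [b [mp oE mg up]]]]].
have [ra rb nab] := min_pair_ends I mp oE.
have [yK xK yx] := min_pair_mem I mp; have /setD1P[_ xK'] := xK.
have uK : uniq (rev [seq l <- root_list s | l != y]).
  by rewrite rev_uniq filter_uniq // (sim_uniq sim).
move: up => /updatedP; rewrite (inv_root_set I) => /(_ xK) [keep km ag].
have [|tabs' [t4 [tabsE U]]] := update_tables_complete (s0 := tabs s) (keep := keep) yx uK.
  move=> l lK lx; apply/(keep_ok_min keep sim I mp) => //.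
  by apply: km => //; rewrite -(mem_kept y sim).
have [t1 fm] : exists t, find_min (root_list s) (tv (tabs s)) (Some (y, x)) t.
  apply: find_min_complete; rewrite ?(sim_roots sim) // => l i.
  rewrite !(sim_roots sim) => lK iK li; have [_ _ _] := mp.
  rewrite (inv_root_set I) => /(_ l i lK iK li).
  by have [/= _ -> _] := sim_agree sim yK xK'; have [/= _ -> _] := sim_agree sim lK iK.
have [[t2 rr] _] := computes_reroot #|T| (succ s) a (Some b).
have [[t3 dl] _] := computes_delete y (root_list s).
exists (Store (rev [seq l <- root_list s | l != y]) (rerooted (succ s) a (Some b)) tabs').
exists (t1 + (1 + (t2 + (t3 + (t4 + 0))))); split.
  exists (Some (y, x)), t1, (1 + (t2 + (t3 + (t4 + 0)))); split=> //.
  exists (Some (a, b)), 1, (t2 + (t3 + (t4 + 0))); split=> //.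
    by split=> //; have [/= _ _ ->] := sim_agree sim yK xK'.
  exists (rerooted (succ s) a (Some b)), t2, (t3 + (t4 + 0)); split=> //.
  exists (rev [seq l <- root_list s | l != y]), t3, (t4 + 0); split=> //.
  by exists tabs', t4, 0.
have fE : forest st' = forest_digraph setT (rerooted (succ s) a (Some b)).
  move: mg; rewrite (inv_forest I) => /mergedP; apply=> //.
  - exact: inv_acyclic I.
  - by apply/eqP; rewrite inE in yK.
  - by rewrite -ra; exact/nesym.
apply: (simulates_step sim I mp oE) => //.
exact: agree_trans ag (agree_updated_store a b sim I mp _ U).
Qed.

Lemma forest_digraph_succ s st u : simulates s st -> invariant P st u -> u = succ s.
Proof.
move=> sim I; apply/boolp.funext/(@forest_digraph_inj _ setT).
by rewrite -(inv_forest I) (sim_forest sim).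
Qed.

Definition outputs_from n (out : seq (seq (T * T))) (S : nat -> state R T) :=
  size out = n /\ forall k, 0 < k <= n ->
    forest (S k) = Digraph [set: T] [set a in nth [::] out (n - k)].

Lemma main_loop_sound n s st out t : simulates s st -> invariant P st (succ s) ->
  #|roots (succ s)| = n.+1 -> main_loop n s out t ->
  exists S, [/\ S n.+1 = st, forall m, 1 < m <= n.+1 -> step P (S m) (S m.-1)
              & outputs_from n.+1 out S].
Proof.
elim: n s st out t => [|n IH] s st out t sim I K1 [F [? [? [oF body _]]]].
  have [F' F'c F'E] := computes_output s; rewrite (F'c.2 _ _ oF) in body *.
  move: body => [-> _]; exists (fun _ => st); split=> //; first by case=> [|[]].
  by split=> // -[|[]] // _; rewrite (sim_forest sim).
have [F' F'c F'E] := computes_output s; rewrite (F'c.2 _ _ oF) in body *.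
move: body => [s' [? [? [sp [Fs [? [? [ml [-> _] _]]]] _]]]].
have [|stS sim'] := step_program_sound sim I _ sp; first by rewrite K1.
have [a [b [nab _ I' _]]] := step_invariant I stS.
have uE := forest_digraph_succ sim' I'; rewrite uE in I'.
have K1' : #|roots (succ s')| = n.+1.
  rewrite -uE roots_reroot_some //; last exact: inv_acyclic I.
  apply: succn_inj; rewrite -K1 [in RHS](cardsD1 (root_of (succ s) a)).
  by rewrite roots_root_of //; exact: inv_acyclic I.
have [S [S1 SS [sF SF]]] := IH _ _ _ _ sim' I' K1' ml.
(* The run of the remaining loop is kept below stage [n.+2], where the current state is put on
   top. *)
exists (fun m => if m == n.+2 then st else S m); split.
- by rewrite eqxx.
- move=> m /andP[m1 mn]; case: eqVneq => [->|mn'].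
    by rewrite /= ltn_eqF // S1.
  have mn2 : m < n.+2 by rewrite ltn_neqAle mn'.
  rewrite ltn_eqF ?(leq_ltn_trans (leq_pred m)) //.
  by apply: SS; rewrite m1.
split=> [|k /andP[k0 kn]] /=; first by rewrite sF.
case: eqVneq => [->|kn']; first by rewrite subnn (sim_forest sim).
have kn2 : k <= n.+1 by rewrite -ltnS ltn_neqAle kn'.
by rewrite subSn //= SF // k0.
Qed.

Lemma main_loop_complete n s S : simulates s (S n.+1) ->
  invariant P (S n.+1) (succ s) -> #|roots (succ s)| = n.+1 ->
  (forall m, 1 < m <= n.+1 -> step P (S m) (S m.-1)) ->
  exists out t, main_loop n s out t /\ outputs_from n.+1 out S.
Proof.
elim: n s => [|n IH] s sim I K1 SS.
  have [F [[t Ft] _] FE] := computes_output s.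
  exists [:: F], (t + 1); split; first by exists F, t, 1.
  by split=> // -[|[]] // _; rewrite (sim_forest sim).
have [F [[t Ft] _] FE] := computes_output s.
have stS : step P (S n.+2) (S n.+1) by apply: (SS n.+2); rewrite /= leqnn.
have [s' [t2 [sp sim']]] := step_program_complete sim I stS.
have [a [b [nab _ I' _]]] := step_invariant I stS.
have uE := forest_digraph_succ sim' I'; rewrite uE in I'.
have K1' : #|roots (succ s')| = n.+1.
  rewrite -uE roots_reroot_some //; last exact: inv_acyclic I.
  apply: succn_inj; rewrite -K1 [in RHS](cardsD1 (root_of (succ s) a)).
  by rewrite roots_root_of //; exact: inv_acyclic I.
have [|Fs [t3 [ml [sF SF]]]] := IH s' sim' I' K1'.
  by move=> m /andP[m1 mn]; apply: SS; rewrite m1 ltnW.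
exists (F :: Fs), (t + (t2 + (t3 + 1))); split.
  exists F, t, (t2 + (t3 + 1)); split=> //; exists s', t2, (t3 + 1); split=> //.
  by exists Fs, t3, 1.
split=> [|k /andP[k0 kn]] /=; first by rewrite sF.
case: (eqVneq k n.+2) => [->|kn']; first by rewrite subnn (sim_forest sim).
have kn2 : k <= n.+1 by rewrite -ltnS ltn_neqAle kn'.
by rewrite subSn //= SF // k0.
Qed.

Lemma computes_initial_store :
  exists2 s, computes (initial_store P) s & simulates s (initial_state P).
Proof.
pose g1 (acc : seq T) i := i :: acc.
pose g2 (u : T -> option T) i : T -> option T := redirect u i None.
pose g3 i (o : T -> T -> option (T * T)) j : T -> T -> option (T * T) :=
  overwrite o i j (if edge P i j then Some (i, j) else None).
pose o0 := foldl (fun o i => foldl (g3 i) o (enum T)) (fun _ _ => None) (enum T).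
exists (Store (foldl g1 [::] (enum T)) (foldl g2 (fun _ => None) (enum T))
             (Tables (potential_matrix P) (barrier_matrix P) o0)).
  apply: computes_bind (computes_traverse _ (g := g1) _ _) _.
    by move=> acc i; exact: computes_op.
  apply: computes_bind (computes_traverse _ (g := g2) _ _) _.
    by move=> acc i; exact: computes_op.
  apply: (computes_bind (a := o0)); last exact: computes_ret.
  apply: computes_traverse => o i; apply: computes_traverse => {}o j.
  apply: computes_bind (computes_op _) _; apply: computes_bind (computes_op _) _.
  have -> : (potential_matrix P i j < +oo)%E = edge P i j.
    by rewrite /potential_matrix; case: ifP; rewrite ?ltry.
  exact: computes_op.
have g1E : foldl g1 [::] (enum T) = rev (enum T).
  by apply: (foldl_invariant (Q := fun pre acc => acc = rev pre)) => // pre i _ ->; rewrite rev_rcons.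
have g2E : foldl g2 (fun _ => None) (enum T) = fun _ => None.
  apply: (foldl_invariant (Q := fun _ u => u = fun _ => None)) => // _ i _ ->.
  by apply/boolp.funext => j; rewrite /g2 /redirect if_same.
have g3E i o l j : foldl (g3 i) o (enum T) l j =
    if l == i then (if edge P l j then Some (l, j) else None) else o l j.
  suff -> : foldl (g3 i) o (enum T) l j =
    if (l == i) && (j \in enum T) then (if edge P l j then Some (l, j) else None) else o l j.
    by rewrite mem_enum andbT.
  apply: (foldl_invariant (Q := fun pre o' => o' l j =
    if (l == i) && (j \in pre) then (if edge P l j then Some (l, j) else None) else o l j)).
    by rewrite andbF.
  move=> pre k o' IH; rewrite /g3 /overwrite mem_rcons inE IH.
  by case: (eqVneq l i) => [->|] //=; case: (eqVneq j k) => [->|].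
have o0E l i : o0 l i = if edge P l i then Some (l, i) else None.
  suff -> : o0 l i = if l \in enum T then (if edge P l i then Some (l, i) else None) else None.
    by rewrite mem_enum.
  apply: (foldl_invariant (Q := fun pre o => o l i =
    if l \in pre then (if edge P l i then Some (l, i) else None) else None)) => //.
  by move=> pre k o IH; rewrite g3E mem_rcons inE IH; case: (eqVneq l k).
rewrite g1E g2E; split=> [|i|//|l i _ _] /=.
- by rewrite rev_uniq enum_uniq.
- by rewrite mem_rev mem_enum !inE.
- by rewrite o0E.
Qed.

End Simulation.

(** * Operation count *)

Section Complexity.
Variables (R : realType) (T : finType) (P : potential_graph R T).
Implicit Types s : store R T.

Lemma step_program_size s s' t :
  step_program s s' t -> size (root_list s') <= size (root_list s).
Proof.
move=> [best [? [? [_ body _]]]]; case: best body => [[y x]|[-> _] //].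
move=> [e [? [? [_ body _]]]]; case: e body => [[a b]|[-> _] //].
move=> [u [? [? [_ [K' [? [? [/(computes_delete _ _).2 -> [? [? [? [_ [-> _] _]]]] _]]]] _]]]].
by rewrite /= size_rev size_filter count_size.
Qed.

(** The summands are the search, the read of the recorded edge, the rerooting, the deletion and the
    table update, where [17] is the bound for one index plus the traversal charge. *)
Lemma bounded_step_program s : size (root_list s) <= #|T| ->
  bounded (step_program s) (#|T| * (#|T| * 6).+1 + (1 + (#|T| * 2 + (#|T| * 3 + (#|T| * 17 + 0))))).
Proof.
move=> sT; apply: bounded_bind.
  by apply: bounded_leq (@bounded_find_min _ _ _ _); rewrite leq_mul // ltnS leq_mul.
move=> [[y x]|] _ _; last exact: bounded_leq (@bounded_ret _ _).
rewrite add1n; apply: bounded_bind_op.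
case: (torig _ _ _) => [[a b]|]; last exact: bounded_leq (@bounded_ret _ _).
apply: bounded_bind (@bounded_reroot _ _ _ _ _) _ => u _ _.
apply: bounded_bind.
  by apply: bounded_leq (@bounded_delete _ _ _); rewrite leq_mul.
move=> K' t /(computes_delete _ _).2 ->.
apply: bounded_bind => [|tabs' _ _]; last exact: bounded_ret.
apply: bounded_leq; last by apply: bounded_traverse => ? ?; exact: bounded_update_index.
by rewrite leq_mul // size_rev size_filter (leq_trans (count_size _ _)).
Qed.

Lemma bounded_main_loop n s : size (root_list s) <= #|T| ->
  bounded (main_loop n s) (n.+1 * (#|T| * 3 + (#|T| * (#|T| * 6).+1 +
    (1 + (#|T| * 2 + (#|T| * 3 + (#|T| * 17 + 0)))) + 1))).
Proof.
elim: n s => [|n IH] s sT /=.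
  rewrite mul1n; apply: bounded_bind (@bounded_output _ _ _) _ => F _ _.
  by apply: bounded_leq (@bounded_op _ _); rewrite leq_addl.
set c := _ + _ in IH *; rewrite mulSn {1}/c -addnA.
apply: bounded_bind (@bounded_output _ _ _) _ => F _ _.
rewrite -addnA; apply: bounded_bind (bounded_step_program sT) _ => s' t sp.
rewrite addnC; apply: bounded_bind => [|Fs _ _]; last exact: bounded_op.
exact/IH/(leq_trans (step_program_size sp)).
Qed.

Lemma bounded_initial_store : bounded (initial_store P)
  (#|T| * 2 + (#|T| * 2 + (#|T| * (#|T| * 4).+1 + 0))).
Proof.
rewrite cardE; apply: bounded_bind => [|K _ _].
  by apply: bounded_traverse => acc i; exact: bounded_op.
apply: bounded_bind => [|u _ _].
  by apply: bounded_traverse => acc i; exact: bounded_op.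
apply: bounded_bind => [|o _ _]; last exact: bounded_ret.
apply: bounded_traverse => o i; apply: bounded_traverse => {}o j.
do 2! apply: bounded_bind_op.
exact: bounded_op.
Qed.

Lemma initial_store_size s t : initial_store P s t -> size (root_list s) <= #|T|.
Proof.
move=> sE; have [s0 s0c sim] := computes_initial_store P; rewrite (s0c.2 _ _ sE).
by rewrite -(card_uniqP (sim_uniq sim)) max_card.
Qed.

(** With [n = #|T|], the accumulated bound is [6 n^3 + 30 n^2 + 7 n], and [43 = 6 + 30 + 7], lower
    powers of the positive [n] being at most [n^3]. *)
Lemma bounded_program : bounded (program P) (43 * #|T| ^ 3).
Proof.
have n0 := vertex_nonempty P.
apply: bounded_leq (bounded_bind bounded_initial_store (fun s t sE =>
  bounded_main_loop (initial_store_size sE))).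
rewrite prednK // !expnS expn0 muln1; move: #|T| n0 => n n0.
have : n * 1 <= n * n by rewrite leq_mul.
have : n * n * 1 <= n * n * n by rewrite leq_mul.
nia.
Qed.

End Complexity.

Local Open Scope ring_scope.

Theorem mainTheorem1 (R : realType) :
  (* (1) the procedure never gets stuck before stage 1, ... *)
  (forall (T : finType) (P : potential_graph R T) (k : nat)
          (S : nat -> state R T),
     (2 <= k <= #|T|)%N -> partial_run P k S ->
     exists st, step P (S k) st) /\
  (* ... and every run produces minimum forests, each a descendant of the
     previous one *)
  (forall (T : finType) (P : potential_graph R T) (S : nat -> state R T),
     run P S ->
     (forall k, (1 <= k <= #|T|)%N -> min_spanning_forest P k (forest (S k))) /\
     (forall k, (2 <= k <= #|T|)%N ->
        descendant P k (forest (S k.-1)) (forest (S k)))) /\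
  (* (2) *)
  (forall (T : finType) (P : potential_graph R T) (k : nat) (F : digraph T),
     (1 <= k <= #|T|)%N -> min_spanning_forest P k F ->
     exists2 S, run P S & forest (S k) = F) /\
  (* (3) the executions of the program are exactly the runs, ... *)
  (forall (T : finType) (P : potential_graph R T),
     (forall out t, program P out t ->
        exists2 S, run P S & outputs_run out S) /\
     (forall S, run P S ->
        exists out t, program P out t /\ outputs_run out S)) /\
  (* ... and on dense digraphs they take O(N^3) operations *)
  (forall c : R, 0 < c ->
     exists C : nat,
       forall (T : finType) (P : potential_graph R T),
         c * (#|T| ^ 2)%:R <= #|arcs (barrier_digraph P)|%:R ->
         forall out t, program P out t -> (t <= C * #|T| ^ 3)%N).
Proof.
split; [|split; [|split; [|split]]].
- by move=> T P k S kN Sk; exact: partial_run_step Sk kN.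
- move=> T P S Sr; split=> k kN; first exact: run_optimal Sr _ _ kN.
  exact: run_descendant Sr _ _ kN.
- by move=> T P k F kN; exact: min_spanning_forest_reached.
- move=> T P; have n0 := vertex_nonempty P.
  have [s sc sim] := computes_initial_store P.
  have I : invariant P (initial_state P) (succ s).
    by have I := initial_invariant P; rewrite -(forest_digraph_succ sim I).
  have K1 : #|roots (succ s)| = #|T|.-1.+1.
    rewrite -(forest_digraph_succ sim (initial_invariant P)) prednK //.
    by apply: eq_card => i; rewrite !inE.
  split=> [out t [s' [t1 [t2 [/(sc.2 _ _) -> ml _]]]]|S [S0 SS]].
    have [S [S0 SS [so SO]]] := main_loop_sound sim I K1 ml; exists S.
      by split; rewrite -?S0 prednK // in SS *.
    by rewrite prednK // in so SO; split.
  have [||//|m|out [t [ml oS]]] := @main_loop_complete _ _ P #|T|.-1 s S.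
  - by rewrite prednK // S0.
  - by rewrite prednK // S0.
  - by rewrite prednK //; exact: SS.
  have [[t0 s0] _] := sc; exists out, (t0 + t)%N; split; first by exists s, t0, t.
  by move: oS; rewrite prednK.
- by move=> c _; exists 43 => T P _ out t; exact: bounded_program.
Qed.
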